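(* Let $\mathcal P$ be an admissible point process on $\mathbb R^d$ whose second correlation function $\rho^{(2)}$ exists and is bounded, let $\xi$ be a score function that is exponentially stabilizing on $\mathcal P$, and suppose that $(\xi,\mathcal P)$ satisfies the $p$-moment condition for some $p\in(2,\infty)$. Suppose the second-order correlations of the $\xi$-weighted measures decay fast, i.e. there are a fast decreasing function $\tilde\phi$ and constants $\tilde C_2<\infty$, $\tilde c_2>0$ such that for all $n\in\mathbb N\cup\{\infty\}$ and distinct $x_1,x_2\in\mathbb R^d$, $|m_{(2)}(x_1,x_2;n)-m_{(1)}(x_1;n)m_{(1)}(x_2;n)|\le\tilde C_2\tilde\phi(\tilde c_2|x_1-x_2|)$. Put $\widehat H_n^\xi(\mathcal P):=\sum_{x\in\mathcal P_n}\xi(x,\mathcal P)$. Then $$\lim_{n\to\infty}n^{-1}\mathrm{Var}\,\widehat H_n^\xi(\mathcal P)=\sigma^2(\xi).$$ If moreover $\sigma^2(\xi)=0$, then $$\lim_{n\to\infty}n^{-(d-1)/d}\,\mathrm{Var}\,\widehat H_n^\xi(\mathcal P)=\sigma^2(\xi,\gamma):=\int_{\mathbb R^d}\bigl(m_{(1)}(\mathbf 0)^2-m_{(2)}(\mathbf 0,x)\bigr)\gamma(x)\,dx\in[0,\infty).$$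
   Context: Fix $d\ge2$. $\mathcal N$ is the space of locally finite subsets of $\mathbb R^d$ (identified with simple Radon counting measures), with its canonical $\sigma$-algebra; a simple point process $\mathcal P$ is a random element of $\mathcal N$. $B_r(x)$ is the closed Euclidean ball, $B_r^c(x)$ its complement. $\mathcal X^{(k)}$ is the set of $k$-tuples of pairwise distinct points of $\mathcal X$. The $k$-th factorial moment measure is $\alpha^{(k)}(\cdot)=E[\mathrm{card}(\mathcal P^{(k)}\cap\cdot)]$; its Lebesgue density $\rho^{(k)}$ is the $k$-point correlation function. The Palm expectations $E_{x_1,\ldots,x_k}$ (probabilities $P_{x_1,\ldots,x_k}$) are determined $\alpha^{(k)}$-a.e. by $E\sum_{(x_1,\ldots,x_k)\in\mathcal P^{(k)}}f(x_1,\ldots,x_k;\mathcal P)=\int E_{x_1,\ldots,x_k}[f(x_1,\ldots,x_k;\mathcal P)]\,\alpha^{(k)}(dx_1\cdots dx_k)$ for measurable $f\ge0$; expressions involving them are understood almost everywhere and suprema are essential suprema. For stationary $\mathcal P$ the Palm expectation $E_{\mathbf 0}$ (and hence $m_{(1)}(\mathbf 0)$, $m_{(2)}(\mathbf 0,x)\,dx$ below) is meaningfully defined by translation covariance. $\mathcal P$ is admissible if it is simple, stationary, has intensity $\rho^{(1)}(\mathbf 0)\in(0,\infty)$, and has correlation functions of all orders. $W_n:=[-\frac12n^{1/d},\frac12n^{1/d}]^d$, $\mathcal P_n:=\mathcal P\cap W_n$, $W_\infty:=\mathbb R^d$, $\mathcal P_\infty:=\mathcal P$. A fast decreasing function is a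 non-increasing $\phi:[0,\infty)\to[0,1]$ with $\lim_{x\to\infty}x^m\phi(x)=0$ for all $m\ge1$. A score function is $\xi:\mathbb R^d\times\mathcal N\to\mathbb R$, measurable in each coordinate, with $\xi(x,\mathcal X)=0$ if $x\notin\mathcal X$, and $\xi(\cdot+y,\cdot+y)=\xi(\cdot,\cdot)$. The radius of stabilization $R^\xi(x,\mathcal X)$, $x\in\mathcal X$, is the smallest $r\in\mathbb N$ with $\xi(x,\mathcal X\cap B_r(x))=\xi(x,(\mathcal X\cap B_r(x))\cup(\mathcal A\cap B_r^c(x)))$ for all locally finite $\mathcal A$ ($\infty$ if none). $\xi$ is exponentially stabilizing on $\mathcal P$ if there are constants $a_l>0$ and $\varphi:[0,\infty)\to[0,1]$ with $\varphi(t)\downarrow0$ as $t\to\infty$ and $\limsup_{t\to\infty}t^{-c}\log\varphi(t)\in(-\infty,0)$ for some $c\in(0,\infty)$, such that for all $l\in\mathbb N$, $t>0$: $\sup_{1\le n\le\infty}\sup_{x_1,\ldots,x_l\in W_n}P_{x_1,\ldots,x_l}(R^\xi(x_1,\mathcal P_n)>t)\le\varphi(a_lt)$. $p$-moment condition ($p\in[1,\infty)$): $\sup_{1\le n\le\infty}\sup_{1\le p'\le\lfloor p\rfloor}\sup_{x_1,\ldots,x_{p'}\in W_n}E_{x_1,\ldots,x_{p'}}\max\{|\xi(x_1,\mathcal P_n)|,1\}^p<\infty$. $m_{(1)}(x;n):=E_x[\xi(x,\mathcal P_n)]\rho^{(1)}(x)$ and $m_{(2)}(x,y;n):=E_{x,y}[\xi(x,\mathcal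 P_n)\xi(y,\mathcal P_n)]\rho^{(2)}(x,y)$; the argument $n$ is omitted when $n=\infty$. $$\sigma^2(\xi):=E_{\mathbf 0}[\xi^2(\mathbf 0,\mathcal P)]\rho^{(1)}(\mathbf 0)+\int_{\mathbb R^d}\bigl(m_{(2)}(\mathbf 0,x)-m_{(1)}(\mathbf 0)^2\bigr)dx.$$ For $W\subset\mathbb R^d$ and $y\in\mathbb R^d$, $\gamma_W(y):=\mathrm{Vol}_d\bigl(W\cap((\mathbb R^d\setminus W)-y)\bigr)$, and $\gamma(y):=\lim_{n\to\infty}\gamma_{W_n}(y)/n^{(d-1)/d}$ (this limit exists for every $y$). *)

(* Defs.v *)
From HB Require Import structures.
From mathcomp Require Import all_boot all_order all_algebra.
From mathcomp Require Import all_classical all_reals all_analysis.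
From mathcomp Require Import measurable_realfun.

Set Implicit Arguments.
Unset Strict Implicit.
Unset Printing Implicit Defensive.

Import Order.TTheory GRing.Theory Num.Theory.
Import numFieldNormedType.Exports.

Local Open Scope classical_set_scope.
Local Open Scope ring_scope.

Section tuple_measure.
Context d (T : measurableType d) (R : realType).

Section cons_measure.
Variables (m1 : {sigma_finite_measure set T -> \bar R}) (k : nat).
Variable m2 : {sigma_finite_measure set (k.-tuple T) -> \bar R}.

Let cons_pair (z : T * k.-tuple T) : k.+1.-tuple T := [tuple of z.1 :: z.2].

Definition cons_measure : set (k.+1.-tuple T) -> \bar R :=
  pushforward (m1 \x m2)%E cons_pair.

Let measurable_cons_pair : measurable_fun [set: T * k.-tuple T] cons_pair.
Proof. exact: measurable_cons measurable_fst measurable_snd. Qed.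

Let cons_measure0 : cons_measure set0 = 0%E.
Proof. by rewrite /cons_measure /pushforward preimage_set0 measure0. Qed.

Let cons_measure_ge0 A : (0 <= cons_measure A)%E.
Proof. exact: measure_ge0. Qed.

Let cons_measure_sigma_additive : semi_sigma_additive cons_measure.
Proof.
move=> F mF tF mUF; rewrite /cons_measure /pushforward preimage_bigcup.
apply: measure_semi_sigma_additive.
- by move=> n; rewrite -[X in measurable X]setTI; exact: measurable_cons_pair.
- apply/trivIsetP => /= i j _ _ ij; rewrite -preimage_setI.
  by move/trivIsetP : tF => /(_ _ _ _ _ ij) ->//; rewrite preimage_set0.
- rewrite -preimage_bigcup -[X in measurable X]setTI.
  exact: measurable_cons_pair.
Qed.

HB.instance Definition _ := isMeasure.Build _ _ _ cons_measure
  cons_measure0 cons_measure_ge0 cons_measure_sigma_additive.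

Let cons_measure_sigma_finite : sigma_finite setT cons_measure.
Proof.
have /sigma_finiteP[F [FT ndF Foo]] := sigma_finiteT m1.
have /sigma_finiteP[G [GT ndG Goo]] := sigma_finiteT m2.
pose split_cons (t : k.+1.-tuple T) : T * k.-tuple T :=
  (thead t, [tuple of behead t]).
have msplit : measurable_fun setT split_cons.
  apply/measurable_fun_pair; first exact: measurable_tnth.
  exact: measurable_behead.
have split_consK z : split_cons (cons_pair z) = z.
  by case: z => x t; congr pair; apply: val_inj.
exists (fun n => split_cons @^-1` (F n `*` G n)).
  rewrite -preimage_bigcup (_ : \bigcup_n _ = setT) ?preimage_setT//.
  rewrite -subTset => -[x y] _.
  have [n _ Fnx] : (\bigcup_i F i) x by rewrite -FT.
  have [m _ Gmy] : (\bigcup_i G i) y by rewrite -GT.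
  exists (maxn n m) => //; split => /=.
  - by move: x Fnx; exact/subsetPset/ndF/leq_maxl.
  - by move: y Gmy; exact/subsetPset/ndG/leq_maxr.
move=> n; have [mF Fn] := Foo n; have [mG Gn] := Goo n; split.
  by rewrite -[X in measurable X]setTI; apply: msplit => //; exact: measurableX.
rewrite /cons_measure /pushforward -comp_preimage.
rewrite (_ : split_cons \o cons_pair = id); last first.
  by apply/funext => z; exact: split_consK.
by rewrite preimage_id product_measure1E// lte_mul_pinfty// ge0_fin_numE.
Qed.

HB.instance Definition _ := Measure_isSigmaFinite.Build _ _ _ cons_measure
  cons_measure_sigma_finite.

End cons_measure.

(* The k-fold product of mu, on the product sigma-algebra of tuples. *)
Fixpoint tuple_measure (mu : {sigma_finite_measure set T -> \bar R}) (k : nat) :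
    {sigma_finite_measure set (k.-tuple T) -> \bar R} :=
  match k with
  | 0 => dirac [tuple]
  | k'.+1 => cons_measure mu (tuple_measure mu k')
  end.

End tuple_measure.

Notation Rd R d := (d.-tuple (measurableTypeR R)).

Section euclidean_space.
Context {R : realType} {d : nat}.
Implicit Types x y : Rd R d.

Definition vzero : Rd R d := [tuple (0 : R) | i < d].

Definition vadd x y : Rd R d := [tuple (tnth x i : R) + (tnth y i : R) | i < d].

Definition vsub x y : Rd R d := [tuple (tnth x i : R) - (tnth y i : R) | i < d].

Definition enorm x : R := Num.sqrt (\sum_(i < d) (tnth x i : R) ^+ 2).

Definition cball x (r : R) : set (Rd R d) := [set y | enorm (vsub y x) <= r].

Definition lebd : {sigma_finite_measure set (Rd R d) -> \bar R} :=
  tuple_measure (@lebesgue_measure R) d.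

Definition lebdk (k : nat) :
    {sigma_finite_measure set (k.-tuple (Rd R d)) -> \bar R} :=
  tuple_measure lebd k.

(* [window (Some n)] is W_n and [window None] is W_oo. *)
Definition window (n : option nat) : set (Rd R d) :=
  if n is Some m then
    [set x | forall i, - (m%:R `^ d%:R^-1 / 2) <= (tnth x i : R)
                       <= m%:R `^ d%:R^-1 / 2]
  else setT.

End euclidean_space.
Arguments lebd {R d}.
Arguments lebdk {R d} k.

Section configurations.
Context {R : realType} {d : nat}.
Local Notation E := (Rd R d).

Definition locally_finite (X : set E) :=
  forall x r, finite_set (X `&` cball x r).

Record config := Config {
  points :> set E ;
  config_locally_finite : locally_finite points }.

Lemma locally_finite0 : locally_finite set0.
Proof. by move=> x r; rewrite set0I. Qed.

Lemma locally_finiteI X (A : set E) :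
  locally_finite X -> locally_finite (X `&` A).
Proof.
move=> lX x r; apply: sub_finite_set (lX x r).
by apply: setSI; exact: subIsetl.
Qed.

Lemma locally_finiteU X Y :
  locally_finite X -> locally_finite Y -> locally_finite (X `|` Y).
Proof. by move=> lX lY x r; rewrite setIUl finite_setU. Qed.

Lemma locally_finite_shift y X :
  locally_finite X -> locally_finite [set vadd x y | x in X].
Proof.
move=> lX c r; have lXy := finite_image (vadd^~ y) (lX (vsub c y) r).
apply: sub_finite_set lXy => _ [[x Xx <-]] xyc; exists x => //; split => //.
move: xyc; rewrite /cball /= (_ : vsub (vadd x y) c = vsub x (vsub c y))//.
by apply: eq_from_tnth => i; rewrite !tnth_mktuple opprB addrA.
Qed.

Definition config0 : config := Config locally_finite0.

Definition crestr (X : config) (A : set E) : config :=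
  Config (locally_finiteI A (config_locally_finite X)).

Definition cunion (X Y : config) : config :=
  Config (locally_finiteU (config_locally_finite X) (config_locally_finite Y)).

Definition cshift (y : E) (X : config) : config :=
  Config (locally_finite_shift y (config_locally_finite X)).

HB.instance Definition _ := gen_eqMixin config.
HB.instance Definition _ := gen_choiceMixin config.
HB.instance Definition _ := isPointed.Build config config0.

(* The canonical sigma-algebra makes all X |-> card (X `&` B), B Borel,
   measurable. *)
Definition config_generators : set (set config) :=
  [set (fun X : config => counting (X `&` B) : \bar R) @^-1` C |
     B in (measurable : set (set E)) & C in (measurable : set (set (\bar R)))].

HB.instance Definition _ :=
  @isMeasurable.Build (sigma_display config_generators) config
    (<<s config_generators >>)
    (@measurable0 _ (g_sigma_algebraType config_generators))
    (@measurableC _ (g_sigma_algebraType config_generators))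
    (@bigcupT_measurable _ (g_sigma_algebraType config_generators)).

Definition distinct_tuples (k : nat) (X : set E) : set (k.-tuple E) :=
  [set t : k.-tuple E | uniq t /\ forall i, X (tnth t i)].

Definition tshift (k : nat) (y : E) (t : k.-tuple E) : k.-tuple E :=
  [tuple vadd (tnth t i) y | i < k].

End configurations.
Arguments config : clear implicits.
Arguments distinct_tuples {R d} k X.

Section point_process.
Context {R : realType} {d : nat} {disp : measure_display}
  {Omega : measurableType disp} {Pr : probability Omega R}.
Local Notation E := (Rd R d).
Variable P : {mfun Omega >-> config R d}.

Definition stationary := forall (y : E) (A : set (config R d)), measurable A ->
  Pr [set w | A (cshift y (P w))] = Pr [set w | A (P w)].

(* This is alpha^(k), as a set function: the integral of the library takes any
   set function, and only uses its values on measurable sets. *)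
Definition factorial_moment (k : nat) : set (k.-tuple E) -> \bar R :=
  fun B => (\int[Pr]_w counting (distinct_tuples k (P w) `&` B))%E.
Arguments factorial_moment k B : clear implicits.

(* [rho] is rho^(k), in its translation invariant version: the density is only
   determined almost everywhere, and invariance gives a meaning to its values
   at tuples containing the origin when P is stationary. *)
Definition correlation_function (k : nat) (rho : k.-tuple E -> R) :=
  [/\ measurable_fun setT rho,
      forall t, 0 <= rho t,
      forall B, measurable B ->
        factorial_moment k B = (\int[lebdk k]_(t in B) (rho t)%:E)%E &
      forall y t, rho (tshift y t) = rho t].

Definition admissible (rho : forall k, k.-tuple E -> R) :=
  [/\ stationary,
      forall k, (0 < k)%N -> correlation_function (rho k) &
      0 < rho 1%N [tuple vzero]].

(* [palm k t] is the Palm law P_{t_1,...,t_k} of the process with the points t_i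
   included (not removed). As for [correlation_function], the version is the
   translation covariant one, so that P_0 is [palm 1 [tuple vzero]] and P_{0,x}
   is [palm 2 [tuple vzero; x]]. *)
Definition palm_version
    (palm : forall k, R.-pker (k.-tuple E) ~> (config R d)) :=
  forall k, (0 < k)%N ->
    (forall f : k.-tuple E * config R d -> \bar R,
       measurable_fun setT f -> (forall z, (0 <= f z)%E) ->
       (\int[Pr]_w (\esum_(t in distinct_tuples k (P w)) f (t, P w)) =
        \int[factorial_moment k]_t \int[palm k t]_X f (t, X))%E) /\
    (forall y t (A : set (config R d)), measurable A ->
       palm k (tshift y t) A = palm k t [set X | A (cshift y X)]).

End point_process.
Arguments factorial_moment {R d disp Omega} Pr P k.
Arguments stationary {R d disp Omega} Pr P.
Arguments correlation_function {R d disp Omega} Pr P {k} rho.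
Arguments admissible {R d disp Omega} Pr P rho.
Arguments palm_version {R d disp Omega} Pr P palm.

Definition fast_decreasing {R : realType} (phi : R -> R) :=
  [/\ forall x, 0 <= x -> 0 <= phi x <= 1,
      forall x y, 0 <= x -> x <= y -> phi y <= phi x &
      forall m, (0 < m)%N -> x ^+ m * phi x @[x --> +oo] --> (0 : R)].

Definition ess_sup_in {disp : measure_display} {T : measurableType disp}
    {R : realType} (mu : set T -> \bar R) (D : set T) (f : T -> \bar R) :
    \bar R :=
  ereal_inf [set M | \forall x \ae mu, D x -> (f x <= M)%E].

(* Some n ranges over n >= 1, and None stands for n = oo. *)
Definition window_index : set (option nat) :=
  [set n | if n is Some m then (0 < m)%N else true].

Section score.
Context {R : realType} {d : nat}.
Local Notation E := (Rd R d).
Variable xi : E -> config R d -> R.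

Definition score_function :=
  [/\ forall x, measurable_fun setT (xi x),
      forall X, measurable_fun setT (xi^~ X),
      forall x (X : config R d), ~ points X x -> xi x X = 0 &
      forall x y X, xi (vadd x y) (cshift y X) = xi x X].

Definition stabilizes_within (x : E) (X : config R d) (r : R) :=
  forall A : config R d,
    xi x (crestr X (cball x r)) =
    xi x (cunion (crestr X (cball x r)) (crestr A (~` cball x r))).

(* The least positive integer at which xi stabilizes, +oo if there is none. *)
Definition radius (x : E) (X : config R d) : \bar R :=
  ereal_inf [set r%:R%:E | r in
    [set r : nat | (0 < r)%N /\ stabilizes_within x X r%:R]].

Section weighted.
Context {disp : measure_display} {Omega : measurableType disp}.
Variables (Pr : probability Omega R) (P : {mfun Omega >-> config R d}).
Variable rho : forall k, k.-tuple E -> R.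
Arguments rho : clear implicits.
Variable palm : forall k, R.-pker (k.-tuple E) ~> (config R d).

Definition windowed (n : option nat) (X : config R d) : config R d :=
  crestr X (window n).

Definition tuple_in_window (n : option nat) (k : nat) : set (k.-tuple E) :=
  [set t | forall i, window n (tnth t i)].
Arguments tuple_in_window n k : clear implicits.

(* The event {R > t} quantifies over all configurations, hence is in general
   only universally measurable: its probability is taken for the completion of
   the Palm law, which is computed by the outer measure [mu_ext]. *)
Definition exp_stabilizing :=
  exists (a : nat -> R) (phi : R -> R),
  [/\ forall l, 0 < a l,
      [/\ forall t, 0 <= t -> 0 <= phi t <= 1,
          forall s t, 0 <= s -> s <= t -> phi t <= phi s &
          phi t @[t --> +oo] --> (0 : R)],
      exists2 c : R, 0 < c &
        let L := limf_esup
          (fun t : R => (t `^ (- c))%:E * lne (phi t)%:E)%E (pinfty_nbhs R) in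
        (-oo < L < 0)%E &
      forall (l : nat) (t : R), 0 < t ->
        (ereal_sup [set ess_sup_in
            (factorial_moment Pr P l.+1) (tuple_in_window n l.+1)
            (fun x => mu_ext (palm l.+1 x)
               [set X | (t%:E < radius (thead x) (windowed n X))%E])
          | n in window_index] <= (phi (a l.+1 * t))%:E)%E].

(* The number p' of points is k.+1. *)
Definition moment_condition (p : R) :=
  (ereal_sup [set ereal_sup
     [set ess_sup_in (factorial_moment Pr P k.+1) (tuple_in_window n k.+1)
        (fun x => \int[palm k.+1 x]_X
           ((Num.max `|xi (thead x) (windowed n X)| 1) `^ p)%:E)
     | k in [set k : nat | (Posz k.+1 <= Num.floor p)%R]]
   | n in window_index] < +oo)%E.

Definition m1 (n : option nat) (x : E) : \bar R :=
  (\int[palm 1%N [tuple x]]_X (xi x (windowed n X))%:E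
   * (rho 1%N [tuple x])%:E)%E.

Definition m2 (n : option nat) (x y : E) : \bar R :=
  (\int[palm 2%N [tuple x; y]]_X (xi x (windowed n X) * xi y (windowed n X))%:E
   * (rho 2%N [tuple x; y])%:E)%E.

(* m_(2)(.;n) and m_(1)(.;n) are densities with respect to Lebesgue measure, so
   "almost everywhere" refers to it. *)
Definition fast_decorrelation :=
  exists (phi : R -> R) (C c : R), [/\ fast_decreasing phi, 0 < c &
    forall n, window_index n ->
      \forall z \ae lebdk 2,
        let x1 := tnth z ord0 in let x2 := tnth z ord_max in
        x1 <> x2 ->
        (`|m2 n x1 x2 - m1 n x1 * m1 n x2| <=
           (C * phi (c * enorm (vsub x1 x2)))%:E)%E].

Definition sigma2 : \bar R :=
  (\int[palm 1%N [tuple vzero]]_X (xi vzero X ^+ 2)%:E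
     * (rho 1%N [tuple vzero])%:E
   + \int[lebd]_x (m2 None vzero x - m1 None vzero ^+ 2))%E.

Definition gammaW (W : set E) (y : E) : \bar R :=
  lebd (W `&` [set vsub z y | z in ~` W]).

Definition boundary_exponent : R := (d%:R - 1) / d%:R.

Definition gamma (y : E) : \bar R :=
  limn (fun n : nat =>
    gammaW (window (Some n)) y * (n%:R `^ (- boundary_exponent))%:E)%E.

Definition sigma2_gamma : \bar R :=
  (\int[lebd]_x ((m1 None vzero ^+ 2 - m2 None vzero x) * gamma x))%E.

Definition Hhat (n : nat) (w : Omega) : R :=
  \sum_(x \in P w `&` window (Some n)) xi x (P w).

End weighted.
End score.
Arguments exp_stabilizing {R d} xi {disp Omega} Pr P palm.
Arguments moment_condition {R d} xi {disp Omega} Pr P palm p.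
Arguments m1 {R d} xi rho palm n x.
Arguments m2 {R d} xi rho palm n x y.
Arguments fast_decorrelation {R d} xi rho palm.
Arguments sigma2 {R d} xi rho palm.
Arguments sigma2_gamma {R d} xi rho palm.
Arguments boundary_exponent R d : clear implicits.
Arguments Hhat {R d} xi {disp Omega} P n w.

(* Main.v *)
Require Import Defs.
From HB Require Import structures.
From mathcomp Require Import all_boot all_order all_algebra.
From mathcomp Require Import all_classical all_reals all_analysis.
From mathcomp Require Import measurable_realfun.
From mathcomp Require Import ring lra.

Set Implicit Arguments.
Unset Strict Implicit.
Unset Printing Implicit Defensive.

Import Order.TTheory GRing.Theory Num.Theory.
Import numFieldNormedType.Exports.

Local Open Scope classical_set_scope.
Local Open Scope ring_scope.
Local Open Scope ereal_scope.

(** Write W for the window, and F(z) for m_(2)(0,z) - m_(1)(0)^2.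

    The square of the sum of the scores over W is a sum over pairs of points,
    which splits into a diagonal and an off-diagonal part. By the Campbell
    formula for points ([campbell1]) the diagonal contributes
    vol(W) E_0[xi^2] rho^(1)(0). By the one for pairs ([campbell2]) and
    translation covariance, the off-diagonal part minus the squared mean
    contributes the integral of vol(W cap (W - z)) F(z) over z. This exact
    formula for the variance is [variance_mark_sum].

    Only the weight vol(W cap (W - z)) still depends on n. For a cube of side
    L = n^(1/d) it is the product of the lengths (L - |z_i|)^+. Divided by n it
    tends to 1 ([cvg_cube_overlap]). Its distance to n, divided by L^(d-1), is
    at most the l^1 norm |z|_1 and tends to it ([overlap_defect_le],
    [cvg_overlap_defect]); in particular gamma(z) = |z|_1. Fast decorrelation
    bounds (1 + |z|_1) |F(z)| by a multiple of prod_i 1/(1 + z_i^2), which is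
    integrable, so dominated convergence applies to both weights. The first
    one gives the limit sigma^2. If sigma^2 = 0, the diagonal part n E_0[xi^2]
    rho^(1)(0) is exactly -n times the integral of F, the terms of volume order
    cancel, and the second weight gives the limit on the scale L^(d-1). This
    limit is nonnegative as a limit of rescaled variances.

    Two points are needed to make this rigorous. Sums of a mark over the points
    in a cube must be measurable: they are integrals against a kernel of
    counting measures ([measurable_sum_cpoints]). The same fact makes the shift
    of configurations jointly measurable, and then xi as well, because
    xi(x, X) = xi(0, X - x) ([measurable_score]). The pair sums must also be
    integrable: the sum of |xi(x) xi(y)| over pairs is at most the sum of
    xi(x)^2 over pairs ([offdiag_norm_le]), whose expectation is finite by the
    moment condition on pairs and the bound on rho^(2). *)

(** * Integration over tuples *)

Section tuple_integral.
Context {d} {T : measurableType d} {R : realType}.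
Variable mu : {sigma_finite_measure set T -> \bar R}.

Lemma measurable_pair_cons k :
  measurable_fun [set: T * k.-tuple T] (fun z => [tuple of z.1 :: z.2]).
Proof. by apply: measurable_cons; [exact: measurable_fst|exact: measurable_snd]. Qed.

Lemma measurable_cons_r k (x : T) :
  measurable_fun [set: k.-tuple T] (fun t => [tuple of x :: t]).
Proof. by apply: measurable_cons; [exact: measurable_cst|exact: measurable_id]. Qed.

Lemma measurable_tuple2 d' (S : measurableType d') (f g : S -> T) :
  measurable_fun setT f -> measurable_fun setT g ->
  measurable_fun setT (fun s => [tuple f s; g s]).
Proof.
move=> mf mg; apply/measurable_fun_tnthP => i.
case: i => -[|[|//]] ilt /=.
- by rewrite (_ : _ \o _ = f).
- by rewrite (_ : _ \o _ = g).
Qed.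

Lemma measurable_tuple1 d' (S : measurableType d') (f : S -> T) :
  measurable_fun setT f -> measurable_fun setT (fun s => [tuple f s]).
Proof.
move=> mf; apply/measurable_fun_tnthP => i.
case: i => -[|//] ilt /=.
by rewrite (_ : _ \o _ = f).
Qed.

Lemma integral_tuple0 (f : 0.-tuple T -> \bar R) : measurable_fun setT f ->
  \int[tuple_measure mu 0]_t f t = f [tuple].
Proof. by move=> mf; rewrite integral_dirac// diracT mul1e. Qed.

Section succ.
Variables (k : nat) (f : k.+1.-tuple T -> \bar R).
Hypotheses (mf : measurable_fun setT f) (f0 : forall t, 0 <= f t).

Lemma integral_tupleS :
  \int[tuple_measure mu k.+1]_t f t =
  \int[mu]_x \int[tuple_measure mu k]_t f [tuple of x :: t].
Proof.
rewrite /= /cons_measure ge0_integral_pushforward//; last exact: measurable_pair_cons.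
rewrite preimage_setT fubini_tonelli1//; last by move=> x; exact: f0.
by apply: measurableT_comp mf _; exact: measurable_pair_cons.
Qed.

Lemma measurable_integral_cons :
  measurable_fun setT (fun x => \int[tuple_measure mu k]_t f [tuple of x :: t]).
Proof.
apply: (@measurable_fun_fubini_tonelli_F _ _ _ _ _ (tuple_measure mu k)
  (fun z => f [tuple of z.1 :: z.2])); last by move=> z; exact: f0.
by apply: measurableT_comp mf _; exact: measurable_pair_cons.
Qed.

End succ.

Lemma integral_tuple1 (f : 1.-tuple T -> \bar R) :
  measurable_fun setT f -> (forall t, 0 <= f t) ->
  \int[tuple_measure mu 1]_t f t = \int[mu]_x f [tuple x].
Proof.
move=> mf f0; rewrite integral_tupleS//; apply: eq_integral => x _.
rewrite integral_tuple0; last exact: measurableT_comp mf (measurable_cons_r _).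
by congr f; exact: val_inj.
Qed.

Lemma integral_tuple2 (f : 2.-tuple T -> \bar R) :
  measurable_fun setT f -> (forall t, 0 <= f t) ->
  \int[tuple_measure mu 2]_t f t = \int[mu]_x \int[mu]_y f [tuple x; y].
Proof.
move=> mf f0; rewrite integral_tupleS//; apply: eq_integral => x _.
by rewrite integral_tuple1//; last exact: measurableT_comp mf (measurable_cons_r _).
Qed.

Lemma measurable_fun_integral_r (f : T * T -> \bar R) :
  measurable_fun setT f -> (forall t, 0 <= f t) ->
  measurable_fun setT (fun x => \int[mu]_y f (x, y)).
Proof. by move=> mf f0; apply: (@measurable_fun_fubini_tonelli_F _ _ _ _ _ mu f). Qed.

Lemma integral_tuple_prod k (f : 'I_k -> T -> \bar R) :
  (forall i, measurable_fun setT (f i)) -> (forall i x, 0 <= f i x) ->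
  \int[tuple_measure mu k]_t (\prod_(i < k) f i (tnth t i)) =
  \prod_(i < k) \int[mu]_x f i x.
Proof.
have mprod n (g : 'I_n -> T -> \bar R) : (forall i, measurable_fun setT (g i)) ->
    measurable_fun setT (fun t : n.-tuple T => \prod_(i < n) g i (tnth t i)).
  move=> mg; under eq_fun do rewrite -big_enum/=.
  elim: (enum _) => [|i s IH].
    under eq_fun do rewrite big_nil; exact: measurable_cst.
  under eq_fun do rewrite big_cons; apply: emeasurable_funM => //.
  by apply: measurableT_comp (mg i) _; exact: measurable_tnth.
elim: k f => [|k IH] f mf f0.
  rewrite integral_tuple0//; first by rewrite !big_ord0.
  exact: mprod.
rewrite integral_tupleS//; first last.
- by move=> t; apply: prode_ge0.
- exact: mprod.
transitivity (\int[mu]_x (f ord0 x * \prod_(i < k) \int[mu]_y f (lift ord0 i) y)).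
  apply: eq_integral => x _; rewrite -IH//.
  rewrite -ge0_integralZl//; first last.
  - by move=> t _; apply: prode_ge0.
  - exact: (mprod k (fun i => f (lift ord0 i))).
  by apply: eq_integral => t _; rewrite big_ord_recl; congr (_ * _);
    apply: eq_bigr => i _; rewrite tnthS.
rewrite ge0_integralZr//; first by rewrite big_ord_recl.
by apply: prode_ge0 => i _; exact: integral_ge0.
Qed.

End tuple_integral.

(** * Translation invariance of Lebesgue measure *)
Section translation.
Context {R : realType}.

Lemma lebesgue_measureD (a : R) (A : set R) : measurable A ->
  pushforward (@lebesgue_measure R)
    ((fun x => x + a)%R : _ -> measurableTypeR R) A = lebesgue_measure A.
Proof.
move=> mA; have mD : measurable_fun setT ((fun x => x + a)%R : _ -> measurableTypeR R).
  exact: measurable_funD.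
apply/esym/lebesgue_measure_unique => // _ [[b c] _ <-] /=.
rewrite /pushforward (_ : _ @^-1` _ = `](b - a)%R, (c - a)%R]%classic).
  rewrite !lebesgue_measure_itv/= !lte_fin ltrD2r.
  by case: ifPn => // _; rewrite -!EFinB; congr EFin; lra.
by apply/seteqP; split => x /=; rewrite !in_itv/=; lra.
Qed.

Lemma ge0_integral_lebesgueD (a : R) (f : measurableTypeR R -> \bar R) :
  measurable_fun setT f -> (forall x, 0 <= f x) ->
  \int[lebesgue_measure]_x f (x + a)%R = \int[lebesgue_measure]_x f x.
Proof.
move=> mf f0.
have ma : measurable_fun setT ((fun x => x + a)%R : _ -> measurableTypeR R).
  exact: measurable_funD.
transitivity (\int[pushforward (@lebesgue_measure R)
    ((fun x => x + a)%R : _ -> measurableTypeR R)]_x f x).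
  by rewrite ge0_integral_pushforward.
by apply: eq_measure_integral => A mA _; exact: lebesgue_measureD.
Qed.

Context {d : nat}.
Local Notation E := (Rd R d).

Lemma measurable_coord (i : 'I_d) : measurable_fun setT (fun x : E => tnth x i).
Proof. exact: measurable_tnth. Qed.

Lemma measurable_vadd d' (S : measurableType d') (f g : S -> E) :
  measurable_fun setT f -> measurable_fun setT g ->
  measurable_fun setT (fun s => vadd (f s) (g s)).
Proof.
move=> mf mg; apply/measurable_fun_tnthP => i.
rewrite (_ : _ \o _ = (fun s => (tnth (f s) i : R) + (tnth (g s) i : R))%R).
  by apply: measurable_funD; apply: measurableT_comp (measurable_coord i) _.
by apply/funext => s /=; rewrite tnth_mktuple.
Qed.

Lemma measurable_vsub d' (S : measurableType d') (f g : S -> E) :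
  measurable_fun setT f -> measurable_fun setT g ->
  measurable_fun setT (fun s => vsub (f s) (g s)).
Proof.
move=> mf mg; apply/measurable_fun_tnthP => i.
rewrite (_ : _ \o _ = (fun s => (tnth (f s) i : R) - (tnth (g s) i : R))%R).
  by apply: measurable_funB; apply: measurableT_comp (measurable_coord i) _.
by apply/funext => s /=; rewrite tnth_mktuple.
Qed.

End translation.

Lemma vadd_cons {R : realType} k (a b : R) (x y : Rd R k) :
  vadd ([tuple of a :: x] : Rd R k.+1) [tuple of b :: y] =
  [tuple of (a + b)%R :: vadd x y].
Proof.
apply: eq_from_tnth => i; rewrite tnth_mktuple.
case: (unliftP ord0 i) => [j ->|->]; last by rewrite !tnth0.
by rewrite !tnthS tnth_mktuple.
Qed.

Lemma ge0_integral_lebdD {R : realType} {d : nat} (a : Rd R d)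
    (f : Rd R d -> \bar R) :
  measurable_fun setT f -> (forall x, 0 <= f x) ->
  \int[lebd]_x f (vadd x a) = \int[lebd]_x f x.
Proof.
elim: d a f => [|k IH] a f mf f0.
  rewrite !integral_tuple0//; first by congr f; apply: val_inj; rewrite tuple0.
  by apply: measurableT_comp mf _; apply: measurable_vadd.
have mfa : measurable_fun setT (fun x => f (vadd x a)).
  by apply: measurableT_comp mf _; exact: measurable_vadd.
rewrite /lebd (integral_tupleS _ mfa (fun=> f0 _)) (integral_tupleS _ mf f0).
rewrite (tuple_eta a).
set a0 := thead a; set a' := [tuple of behead a].
under eq_integral => x _ do under eq_integral => t _ do rewrite vadd_cons.
transitivity (\int[lebesgue_measure]_x
    \int[lebd]_t f [tuple of ((x : R) + (a0 : R))%R :: t]).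
  apply: eq_integral => x _.
  rewrite (IH a' (fun t => f [tuple of ((x : R) + (a0 : R))%R :: t]))//.
  exact: measurableT_comp mf (measurable_cons_r _).
rewrite (@ge0_integral_lebesgueD _ a0
  (fun x : measurableTypeR R => \int[lebd]_t f [tuple of x :: t]))//.
- exact: measurable_integral_cons.
- by move=> x; exact: integral_ge0.
Qed.

(** * Measurability of sums over configurations *)
Section configurations.
Context {R : realType} {d : nat}.
Local Notation E := (Rd R d).
Import HBNNSimple.
Local Notation config := (config R d).

Definition cube (a : R) : set E :=
  [set x | forall i, (- a <= (tnth x i : R) <= a)%R].

Lemma measurable_cube a : measurable (cube a).
Proof.
rewrite (_ : cube a = \bigcap_(i in [set: 'I_d])
    ((fun x : E => tnth x i : measurableTypeR R) @^-1` `[(- a)%R, a])).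
  apply: fin_bigcap_measurable => // i _.
  by rewrite -[X in measurable X]setTI; apply: measurable_coord.
apply/seteqP; split => x /= xa i; first by move=> _ /=; rewrite in_itv/= xa.
by have := xa i Logic.I; rewrite /= in_itv/=.
Qed.

Lemma sub_cube a b : (a <= b)%R -> cube a `<=` cube b.
Proof.
move=> ab x xa i; have /andP[ax xa'] := xa i.
by rewrite (le_trans _ ax) ?lerN2// (le_trans xa').
Qed.

Lemma cube_cball a : (0 <= a)%R ->
  cube a `<=` cball (@vzero R d) (Num.sqrt (d%:R * a ^+ 2)).
Proof.
move=> a0 x xa; rewrite /cball /= /enorm ler_wsqrtr//.
rewrite mulr_natl -[X in (_ *+ X)%R]card_ord -sumr_const.
apply: ler_sum => i _; rewrite !tnth_mktuple subr0.
have /andP[ax xa'] := xa i.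
by rewrite -real_normK ?num_real// lerXn2r ?nnegrE// ler_norml ax.
Qed.

Lemma finite_cube (X : config) a : finite_set (X `&` cube a).
Proof.
have a'a : (a <= Num.max a 0)%R by rewrite le_max lexx.
have a'0 : (0 <= Num.max a 0)%R by rewrite le_max lexx orbT.
apply: sub_finite_set (config_locally_finite X vzero _).
by apply: setIS; apply: subset_trans (sub_cube a'a) (cube_cball a'0).
Qed.

Lemma bigcup_cube : \bigcup_n cube n%:R = setT.
Proof.
rewrite -subTset => x _.
exists (\max_(i < d) (Num.truncn `|tnth x i : R|%R).+1)%N => // i /=.
rewrite -ler_norml; apply: (@le_trans _ _ ((Num.truncn `|tnth x i : R|%R).+1)%:R).
  by apply/ltW; exact: truncnS_gt.
rewrite ler_nat.
exact: (@leq_bigmax _ (fun i => (Num.truncn `|tnth x i : R|%R).+1) i).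
Qed.

Definition cpoints (a : R) (X : config) : seq E := finmap.enum_fset (fset_set (X `&` cube a)).

Lemma mem_cpoints a X x : (x \in cpoints a X) = (x \in (X `&` cube a)).
Proof. exact/in_fset_set/finite_cube. Qed.

Lemma uniq_cpoints a X : uniq (cpoints a X).
Proof. exact: finmap.fset_uniq. Qed.

Lemma counting_seq (A : set E) (s : seq E) : uniq s -> A = [set` s] ->
  counting A = (size s)%:R%:E :> \bar R.
Proof.
move=> us ->; have fs : finite_set [set` s] by [].
rewrite /counting asboolT//; congr (_%:R%:E).
apply/perm_size/uniq_perm => //.
by move=> x; rewrite in_fset_set//; apply/idP/idP => [/set_mem|xs] //; exact/mem_set.
Qed.

(** A sum of Dirac masses, so that integrals against it are finite sums; its
    values are counts by [cube_countingE]. *)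
Definition cube_counting (a : R) (X : config) : {measure set E -> \bar R} :=
  msum (fun i => dirac (nth vzero (cpoints a X) i)) (size (cpoints a X)).

Lemma cube_countingE a X B : cube_counting a X B = counting (X `&` (cube a `&` B)).
Proof.
rewrite (@counting_seq _ [seq x <- cpoints a X | x \in B]); first last.
- apply/seteqP; split => x /=; rewrite mem_filter mem_cpoints.
    by move=> [Xx [ax Bx]]; apply/andP; split; exact/mem_set.
  by move=> /andP[/set_mem Bx /set_mem[Xx ax]].
- exact/filter_uniq/uniq_cpoints.
rewrite /cube_counting /= /msum -(big_mkord xpredT
  (fun i => \d_(nth vzero (cpoints a X) i) B)) -(big_nth vzero xpredT
  (fun x => \d_x B)) size_filter.
elim: (cpoints a X) => [|x s IH]; first by rewrite big_nil.
by rewrite big_cons IH/= natrD EFinD diracE.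
Qed.

Lemma integral_cube_counting a X (g : E -> \bar R) :
  measurable_fun setT g -> (forall x, 0 <= g x) ->
  \int[cube_counting a X]_x g x = \sum_(x <- cpoints a X) g x.
Proof.
move=> mg g0; rewrite /cube_counting ge0_integral_measure_sum//.
rewrite -(big_mkord xpredT
  (fun i => \int[\d_(nth vzero (cpoints a X) i)]_x g x)) [RHS](big_nth vzero).
by apply: eq_bigr => i _; rewrite integral_dirac// diracT mul1e.
Qed.

Lemma measurable_counting (B : set E) : measurable B ->
  measurable_fun setT (fun X : config => counting (X `&` B) : \bar R).
Proof.
move=> mB _ C mC; rewrite setTI.
by apply: sub_sigma_algebra; exists B => //; exists C.
Qed.

(** The counting measures form a kernel whose masses are finite, though not
    uniformly bounded, which is enough for the sections of a measurable set to
    have measurable mass. The configuration may depend on a parameter [s]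
    shared with the mark: this is what shifted configurations need. *)
Lemma measurable_sum_cpoints d' (S : measurableType d') (Q : S -> config) a
    (g : S * E -> \bar R) :
  measurable_fun setT Q -> measurable_fun setT g -> (forall z, 0 <= g z) ->
  measurable_fun setT (fun s => \sum_(x <- cpoints a (Q s)) g (s, x)).
Proof.
move=> mQ mg g0.
pose l s := cube_counting a (Q s).
have ml U : measurable U -> measurable_fun setT (fun s => l s U).
  move=> mU; rewrite (_ : (fun s => _) =
      (fun X : config => counting (X `&` (cube a `&` U))) \o Q).
    apply: measurableT_comp mQ; apply: measurable_counting.
    by apply: measurableI => //; exact: measurable_cube.
  by apply/funext => s; rewrite /l cube_countingE.
pose lk : R.-ker S ~> E := HB.pack l (isKernel.Build _ _ _ _ R l ml).
rewrite (_ : (fun s => _) = (fun s => \int[l s]_x g (s, x))); last first.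
  apply/funext => s; rewrite integral_cube_counting//.
  exact: measurableT_comp mg (measurable_pair1 _).
pose g_ := nnsfun_approx measurableT mg.
apply: (@measurable_fun_xsection_integral _ _ _ _ _ _ _ g_).
- by move=> b c bc; exact/nd_nnsfun_approx.
- by move=> z; exact/cvg_nnsfun_approx.
move=> n r.
have mA : measurable (g_ n @^-1` [set r]) by [].
have bd s : exists M, forall U, measurable U -> mrestr (lk s) measurableT U < M%:E.
  exists (size (cpoints a (Q s))).+1%:R => U mU.
  apply: (@le_lt_trans _ _ (l s setT)).
    by rewrite /mrestr setIT; apply: le_measure; rewrite ?inE.
  rewrite /l cube_countingE setIT (@counting_seq _ (cpoints a (Q s))).
  - by rewrite lte_fin ltr_nat.
  - exact: uniq_cpoints.
  - by apply/seteqP; split => x /=; rewrite mem_cpoints; [exact: mem_set|exact: set_mem].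
have := measurable_prod_subset_xsection_kernel bd mA.
case=> _; apply: eq_measurable_fun => s _.
by rewrite /mrestr setIT.
Qed.

Lemma measurable_point (x : E) : measurable [set x].
Proof.
rewrite (_ : [set x] = \bigcap_(i in [set: 'I_d])
    ((fun y : E => tnth y i : measurableTypeR R) @^-1` [set tnth x i])).
  apply: fin_bigcap_measurable => // i _.
  by rewrite -[X in measurable X]setTI; apply: measurable_coord => //.
apply/seteqP; split => y /=; first by move=> -> i.
by move=> yx; apply: eq_from_tnth => i; exact: (yx i).
Qed.

Lemma measurable_finite_set (A : set E) : finite_set A -> measurable A.
Proof.
move=> fA; rewrite (_ : A = \bigcup_(x in A) [set x]).
  by apply: fin_bigcup_measurable => // x _; exact: measurable_point.
by apply/seteqP; split => [x Ax|x [y Ay ->]] //; exists x.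
Qed.

(** A configuration is a countable union of finite sets. *)
Lemma measurable_config (X : config) (B : set E) : measurable B ->
  measurable (X `&` B).
Proof.
move=> mB; apply: measurableI => //.
rewrite -(setIT (points X)) -bigcup_cube setI_bigcupr.
apply: bigcupT_measurable => n.
by have := measurable_finite_set (finite_cube X n%:R).
Qed.

(** Counts in an unbounded set are limits of finite sums. *)
Lemma cvg_counting_cube (X : config) (B : set E) : measurable B ->
  counting (X `&` (cube n%:R `&` B)) @[n --> \oo] --> (counting (X `&` B) : \bar R).
Proof.
move=> mB.
rewrite (_ : X `&` B = \bigcup_n (X `&` (cube n%:R `&` B))); last first.
  by rewrite -setI_bigcupr -setI_bigcupl bigcup_cube setTI.
have mc n : measurable (X `&` (cube n%:R `&` B)).
  by apply: measurable_config; apply: measurableI => //; exact: measurable_cube.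
apply: (@nondecreasing_cvg_mu _ E R counting) => //.
  exact: bigcupT_measurable.
move=> m n mn; apply/subsetPset => x [Xx [xm Bx]]; split => //; split => //.
by apply: sub_cube xm; rewrite ler_nat.
Qed.

Lemma counting_card_eq (A B : set E) : (A #= B)%card ->
  counting A = counting B :> \bar R.
Proof.
move=> AB; rewrite /counting (eq_finite_set AB).
case: ifPn => // /asboolP fB; congr (_%:R%:E); apply: card_fset_set.
apply: card_eq_trans AB _; rewrite -[X in (X #= _)%card](fset_setK fB).
exact/card_eq_fsetP.
Qed.

Lemma vaddK (x y : E) : vsub (vadd x y) y = x.
Proof. by apply: eq_from_tnth => i; rewrite !tnth_mktuple addrK. Qed.

Lemma vsubK (x y : E) : vadd (vsub x y) y = x.
Proof. by apply: eq_from_tnth => i; rewrite !tnth_mktuple subrK. Qed.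

Lemma counting_cshift (y : E) (X : config) (B : set E) :
  counting (cshift y X `&` B) = counting (X `&` [set z | B (vadd z y)]) :> \bar R.
Proof.
rewrite (_ : cshift y X `&` B =
    (vadd^~ y) @` (X `&` [set z | B (vadd z y)])).
  apply/counting_card_eq/inj_card_eq => z z' _ _ zz'.
  by rewrite -(vaddK z y) zz' vaddK.
apply/seteqP; split => z /=; first by move=> [[x Xx <-] Bx]; exists x.
by move=> [x [Xx Bx] <-]; split => //; exists x.
Qed.

(** The number of points of the shifted configuration in [B] is the sum of
    1_B(z + y) over the points z of X, a mark that depends on y and z jointly. *)
Lemma measurable_cshift d' (S : measurableType d') (f : S -> E) (Q : S -> config) :
  measurable_fun setT f -> measurable_fun setT Q ->
  measurable_fun setT (fun s => cshift (f s) (Q s)).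
Proof.
move=> mf mQ; apply: (@measurability _ _ _ _ _ _ config_generators) => //.
move=> _ [_ [B mB [C mC <-]] <-]; rewrite setTI.
rewrite (_ : _ @^-1` _ = (fun s => counting (cshift (f s) (Q s) `&` B)) @^-1` C)//.
rewrite -[X in measurable X]setTI.
suff : measurable_fun setT (fun s => counting (cshift (f s) (Q s) `&` B) : \bar R).
  exact.
pose h n s := \sum_(z <- cpoints n%:R (Q s)) (\1_B (vadd z (f s)))%:E : \bar R.
have mB' s : measurable [set z | B (vadd z (f s))].
  rewrite -[X in measurable X]setTI.
  exact: (measurable_vadd (@measurable_id _ _ _) (measurable_cst _)).
apply: (emeasurable_fun_cvg h) => //.
- move=> n; apply: (@measurable_sum_cpoints _ _ _ _ (fun z => (\1_B (vadd z.2 (f z.1)))%:E)).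
  + exact: mQ.
  + apply/measurable_EFinP; apply: measurableT_comp.
      exact: measurable_indic.
    by apply: measurable_vadd => //; apply: measurableT_comp mf _.
  + by move=> z; rewrite lee_fin.
- move=> s _; rewrite counting_cshift.
  rewrite (_ : h^~ s = (fun n => counting (Q s `&` (cube n%:R `&` [set z | B (vadd z (f s))])))).
    exact: cvg_counting_cube.
  apply/funext => n; rewrite -cube_countingE -[LHS]integral_cube_counting//.
  + rewrite -[in RHS](setIT [set z | B (vadd z (f s))]) -integral_indic//.
  + apply/measurable_EFinP; apply: measurableT_comp; first exact: measurable_indic.
    exact: measurable_vadd.
Qed.

(** Measurability in the configuration at one point is enough, since
    translation invariance moves every point to the origin. *)
Lemma measurable_score (xi : E -> config -> R) : score_function xi ->
  measurable_fun setT (fun z : E * config => xi z.1 z.2).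
Proof.
move=> [mxi _ _ xiD].
rewrite (_ : (fun z => _) =
    (fun z : E * config => xi vzero (cshift (vsub vzero z.1) z.2))).
  apply: (measurableT_comp (mxi vzero)); apply: measurable_cshift => //.
  exact: measurable_vsub.
apply/funext => -[x X] /=; rewrite -(xiD x (vsub vzero x) X); congr (xi _ _).
by apply: eq_from_tnth => i; rewrite !tnth_mktuple sub0r addrN.
Qed.

End configurations.

(** * Set functions with a density *)
Section density.
Context {d} {T : measurableType d} {R : realType}.
Variables (mu : {measure set T -> \bar R}).
Import HBNNSimple.

(** The integral is a supremum over simple functions, whose level sets are
    measurable: it only sees the values of [alpha] on measurable sets. *)
Lemma eq_setfun_integral (alpha : set T -> \bar R) (nu : {measure set T -> \bar R})
    (f : T -> \bar R) : (forall A, measurable A -> alpha A = nu A) ->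
  \int[alpha]_x f x = \int[nu]_x f x.
Proof.
move=> alphaE.
have sE (h : {nnsfun T >-> R}) : sintegral alpha h = sintegral nu h.
  by apply: eq_fsbigr => r _; rewrite alphaE.
rewrite /integral; congr (ereal_sup _ - ereal_sup _);
  by apply/seteqP; split => _ [h hf <-]; exists h; rewrite // sE.
Qed.

Variables (rho : T -> R).
Hypotheses (mrho : measurable_fun setT rho) (rho0 : forall x, (0 <= rho x)%R).

Let nu A := \int[mu]_(x in A) (rho x)%:E.

Let nu0 : nu set0 = 0. Proof. exact: integral_set0. Qed.

Let nu_ge0 A : 0 <= nu A.
Proof. by apply: integral_ge0 => x _; rewrite lee_fin. Qed.

Let nu_sigma : semi_sigma_additive nu.
Proof.
apply: semi_sigma_additive_nng_induced; first exact/measurable_EFinP.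
by move=> x; rewrite lee_fin.
Qed.

HB.instance Definition _ := isMeasure.Build _ _ _ nu nu0 nu_ge0 nu_sigma.

Lemma ge0_integral_density (alpha : set T -> \bar R) (g : T -> \bar R) :
  (forall A, measurable A -> alpha A = \int[mu]_(x in A) (rho x)%:E) ->
  measurable_fun setT g -> (forall x, 0 <= g x) ->
  \int[alpha]_x g x = \int[mu]_x (g x * (rho x)%:E).
Proof.
move=> alphaE mg g0; rewrite (@eq_setfun_integral alpha nu)//.
pose h := nnsfun_approx measurableT mg.
have hg x : (h n x)%:E @[n --> \oo] --> g x by exact: cvg_nnsfun_approx.
have ndh x : {homo (fun n => (h n x)%:E) : m n / (m <= n)%N >-> m <= n}.
  by move=> m n mn; rewrite lee_fin; exact/lefP/nd_nnsfun_approx.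
have mh n : measurable_fun setT (fun x => (h n x)%:E).
  exact/measurable_EFinP.
have mrhoE : measurable_fun setT (EFin \o rho) by exact/measurable_EFinP.
transitivity (limn (fun n => \int[nu]_x (h n x)%:E)).
  rewrite -monotone_convergence//.
  - by apply: eq_integral => x _; apply/esym/cvg_lim.
  - by move=> n x _; rewrite lee_fin.
transitivity (limn (fun n => \int[mu]_x ((h n x)%:E * (rho x)%:E))); last first.
  rewrite -monotone_convergence//.
  - by apply: eq_integral => x _; apply/cvg_lim => //; apply: cvgeZr.
  - by move=> n; apply: emeasurable_funM.
  - by move=> n x _; rewrite -EFinM lee_fin mulr_ge0.
  - by move=> x _ m n mn; rewrite lee_wpmul2r ?lee_fin//; exact/lefP/nd_nnsfun_approx.
congr (limn _); apply/funext => n.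
have h0 y x : 0 <= (y * \1_(h n @^-1` [set y]) x)%:E.
  by rewrite EFinM nnfun_muleindic_ge0.
rewrite integralT_nnsfun sintegralE.
transitivity (\int[mu]_x \sum_(y \in range (h n))
    ((y * \1_(h n @^-1` [set y]) x)%:E * (rho x)%:E)); last first.
  apply: eq_integral => x _; rewrite [in RHS]fimfunE -fsumEFin//.
  by rewrite ge0_mule_fsuml// => y.
rewrite ge0_integral_fsum//; last 2 first.
- move=> y; apply: emeasurable_funM => //.
  by apply/measurable_EFinP; apply: measurable_funM.
- by move=> y x _; rewrite mule_ge0 ?lee_fin//; exact: h0.
apply: eq_fsbigr => y /[!inE] -[x _ <-{y}].
transitivity ((h n x)%:E *
    \int[mu]_z ((\1_(h n @^-1` [set h n x]) z)%:E * (rho z)%:E)).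
  congr (_ * _); rewrite /= /nu integral_mkcond; apply: eq_integral => z _.
  by rewrite patchE indicE; case: ifP; rewrite ?mul1e ?mul0e.
rewrite -ge0_integralZl//; last 3 first.
- by apply: emeasurable_funM => //; apply/measurable_EFinP.
- by move=> z _; rewrite mule_ge0 ?lee_fin.
- by rewrite lee_fin.
by apply: eq_integral => z _; rewrite EFinM muleA.
Qed.

End density.

(** * Sums over tuples of distinct points *)
Section distinct.
Context {R : realType} {d : nat}.
Local Notation E := (Rd R d).
Local Notation config := (config R d).

Lemma tuple1_eta (t : 1.-tuple E) : t = [tuple tnth t ord0].
Proof. by apply: eq_from_tnth => i; rewrite ord1. Qed.

Lemma tuple2_eta (t : 2.-tuple E) : t = [tuple tnth t ord0; tnth t ord_max].
Proof.
apply: eq_from_tnth => -[[|[|//]] i2].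
- by rewrite (_ : Ordinal i2 = ord0)//; exact: val_inj.
- by rewrite (_ : Ordinal i2 = ord_max)//; exact: val_inj.
Qed.

Lemma esum_cpoints (X : config) a (g : E -> \bar R) : (forall x, 0 <= g x) ->
  \esum_(x in X `&` cube a) g x = \sum_(x <- cpoints a X) g x.
Proof.
move=> g0; rewrite esum_fset//; last exact: finite_cube.
by rewrite fsbig_finite//; exact: finite_cube.
Qed.

Lemma esum_distinct_tuples1 (X : config) a (g : E -> \bar R) :
  (forall x, 0 <= g x) ->
  \esum_(t in distinct_tuples 1 X)
    ((\1_(cube a) (tnth t ord0))%:E * g (tnth t ord0)) =
  \sum_(x <- cpoints a X) g x.
Proof.
move=> g0; rewrite -esum_cpoints//.
transitivity (\esum_(t in distinct_tuples 1 X `&` [set t | cube a (tnth t ord0)])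
    g (tnth t ord0)).
  rewrite [RHS]esum_mkcondr; apply: eq_esum => t _; rewrite indicE.
  case: ifPn => [/set_mem a0|/negP h]; first by rewrite mem_set// mul1e.
  have [/set_mem a0|] := boolP (tnth t ord0 \in cube a); last by rewrite mul0e.
  by exfalso; apply: h; exact/mem_set.
have -> : distinct_tuples 1 X `&` [set t | cube a (tnth t ord0)] =
    (fun x : E => [tuple x]) @` (X `&` cube a).
  apply/seteqP; split => t /=.
    by move=> [[_ Xt] at_]; exists (tnth t ord0); rewrite -?tuple1_eta.
  by move=> [x [Xx ax] <-]; split => //; split => // i; rewrite ord1.
rewrite esum_image//.
by move=> x y _ _ /(congr1 (fun t => tnth t ord0)).
Qed.

(** The indicators cut the sum over all pairs, which may be infinite, down to
    the finitely many pairs of points of the cube. *)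
Lemma esum_distinct_tuples2 (X : config) a (g : E -> E -> \bar R) :
  (forall x y, 0 <= g x y) ->
  \esum_(t in distinct_tuples 2 X)
    ((\1_(cube a) (tnth t ord0) * \1_(cube a) (tnth t ord_max))%:E *
      g (tnth t ord0) (tnth t ord_max)) =
  \sum_(x <- cpoints a X) \sum_(y <- cpoints a X | y != x) g x y.
Proof.
move=> g0.
transitivity (\esum_(t in distinct_tuples 2 X `&`
    [set t | cube a (tnth t ord0) /\ cube a (tnth t ord_max)])
    g (tnth t ord0) (tnth t ord_max)).
  rewrite [RHS]esum_mkcondr; apply: eq_esum => t _; rewrite !indicE.
  case: ifPn => [/set_mem[a0 a1]|/negP h]; first by rewrite !mem_set// mulr1 mul1e.
  have [/set_mem a0|] := boolP (tnth t ord0 \in cube a); last by rewrite mul0r mul0e.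
  have [/set_mem a1|] := boolP (tnth t ord_max \in cube a); last by rewrite mulr0 mul0e.
  by exfalso; apply: h; exact/mem_set.
pose I := X `&` cube a; pose J (x : E) := I `&` [set y | y != x].
have -> : distinct_tuples 2 X `&`
    [set t | cube a (tnth t ord0) /\ cube a (tnth t ord_max)] =
    (fun z : E * E => [tuple z.1; z.2]) @` (I `*`` J).
  apply/seteqP; split => t /=.
    move=> [[ut Xt] [a0 a1]]; exists (tnth t ord0, tnth t ord_max); last first.
      by rewrite -tuple2_eta.
    split => //=; split => //=; move: ut; rewrite {1}(tuple2_eta t)/= inE andbT.
    by rewrite eq_sym.
  move=> [[x y] /= [[Xx ax] [[Xy ay] xy]] <-]; split => //; split.
    by rewrite /= inE andbT eq_sym.
  by case=> -[|[|//]].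
rewrite esum_image; last first.
  move=> [x y] [x' y'] _ _ /= h.
  have := congr1 (fun t => tnth t ord0) h; have := congr1 (fun t => tnth t ord_max) h.
  by rewrite /tnth /= => -> ->.
rewrite -(@esum_esum _ _ _ I J (fun x y => g x y))//.
rewrite esum_cpoints; last by move=> x; apply: esum_ge0.
apply: eq_bigr => x _; rewrite esum_mkcondr esum_cpoints; last by move=> y; case: ifP.
rewrite [RHS]big_mkcond/=; apply: eq_bigr => y _.
by rewrite mem_setE.
Qed.

End distinct.

(** * Differences of points in a cube *)
Section overlap.
Context {R : realType} {d : nat}.
Local Notation E := (Rd R d).

(** The volume of W cap (W - z) for a cube W, as the integral of a product
    of indicators, to which Tonelli applies directly. *)
Definition overlap (a : R) (z : E) : \bar R :=
  \int[lebd]_x (\1_(cube a) x * \1_(cube a) (vadd z x))%:E.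

Lemma measurable_indic_cube d' (S : measurableType d') (f : S -> E) (a : R) :
  measurable_fun setT f -> measurable_fun setT (fun s => (\1_(cube a) (f s))%:E : \bar R).
Proof.
move=> mf; apply/measurable_EFinP; apply: (measurableT_comp _ mf).
by apply: measurable_indic; exact: measurable_cube.
Qed.

Lemma measurable_indic_cube2 d' (S : measurableType d') (f g : S -> E) (a : R) :
  measurable_fun setT f -> measurable_fun setT g ->
  measurable_fun setT (fun s => (\1_(cube a) (f s) * \1_(cube a) (g s))%:E : \bar R).
Proof.
move=> mf mg; under eq_fun do rewrite EFinM.
by apply: emeasurable_funM; exact: measurable_indic_cube.
Qed.

Lemma indic_cube2_ge0 a (x y : E) : 0 <= (\1_(cube a) x * \1_(cube a) y)%:E :> \bar R.
Proof. by rewrite lee_fin mulr_ge0. Qed.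

Lemma measurable_overlap (a : R) : measurable_fun setT (overlap a).
Proof.
apply: (@measurable_fun_integral_r _ _ _ lebd
  (fun z => (\1_(cube a) z.2 * \1_(cube a) (vadd z.1 z.2))%:E)).
- apply: measurable_indic_cube2 => //; exact: measurable_vadd.
- by move=> z; exact: indic_cube2_ge0.
Qed.

Lemma overlap_ge0 (a : R) z : 0 <= overlap a z.
Proof. by apply: integral_ge0 => x _; exact: indic_cube2_ge0. Qed.

(** Substitute y = x + z in the inner integral, then exchange the integrals. *)
Lemma integral_cube_diff (a : R) (Phi : E -> \bar R) :
  measurable_fun setT Phi -> (forall z, 0 <= Phi z) ->
  \int[lebd]_x \int[lebd]_y
    ((\1_(cube a) x * \1_(cube a) y)%:E * Phi (vsub y x)) =
  \int[lebd]_z (overlap a z * Phi z).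
Proof.
move=> mPhi Phi0.
transitivity (\int[lebd]_x \int[lebd]_z
    ((\1_(cube a) x * \1_(cube a) (vadd z x))%:E * Phi z)).
  apply: eq_integral => x _.
  rewrite -(@ge0_integral_lebdD _ _ x
    (fun y => (\1_(cube a) x * \1_(cube a) y)%:E * Phi (vsub y x)))//.
  - by apply: eq_integral => z _; rewrite vaddK.
  - apply: emeasurable_funM; first exact: measurable_indic_cube2.
    by apply: measurableT_comp mPhi _; exact: measurable_vsub.
  - by move=> y; rewrite mule_ge0// indic_cube2_ge0.
rewrite (@fubini_tonelli _ _ _ _ _ lebd lebd (fun p =>
  (\1_(cube a) p.1 * \1_(cube a) (vadd p.2 p.1))%:E * Phi p.2)).
- apply: eq_integral => z _; rewrite /overlap -ge0_integralZr//.
  by apply: measurable_indic_cube2 => //; exact: measurable_vadd.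
- apply: emeasurable_funM; last exact: (measurableT_comp mPhi).
  by apply: measurable_indic_cube2 => //; exact: measurable_vadd.
- by move=> z; rewrite mule_ge0// indic_cube2_ge0.
Qed.

End overlap.

(** * Campbell formulas *)
Section campbell.
Context {R : realType} {d : nat} {disp : measure_display}
  {Omega : measurableType disp} {Pr : probability Omega R}.
Local Notation E := (Rd R d).
Local Notation config := (config R d).
Context {P : {mfun Omega >-> config}} {rho : forall k : nat, k.-tuple E -> R}
  {palm : forall k : nat, R.-pker (k.-tuple E) ~> config}.
Arguments rho : clear implicits.
Hypotheses (adm : admissible Pr P rho) (pv : palm_version Pr P palm).

Lemma measurable_rho k : (0 < k)%N -> measurable_fun setT (rho k).
Proof. by case: adm => _ h _ /h[]. Qed.

Lemma rho_ge0 k t : (0 < k)%N -> (0 <= rho k t)%R.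
Proof. by case: adm => _ h _ /h[]. Qed.

Lemma rho_tshift k t y : (0 < k)%N -> rho k (tshift y t) = rho k t.
Proof. by case: adm => _ h _ /h[]. Qed.

Lemma measurable_palm_integral k (f : k.-tuple E * config -> \bar R) :
  measurable_fun setT f -> (forall z, 0 <= f z) ->
  measurable_fun setT (fun t => \int[palm k t]_X f (t, X)).
Proof. by move=> mf f0; apply: (measurable_fun_integral_finite_kernel f (palm k)). Qed.

Lemma campbell k (f : k.-tuple E * config -> \bar R) : (0 < k)%N ->
  measurable_fun setT f -> (forall z, 0 <= f z) ->
  \int[Pr]_w (\esum_(t in distinct_tuples k (P w)) f (t, P w)) =
  \int[lebdk k]_t ((\int[palm k t]_X f (t, X)) * (rho k t)%:E).
Proof.
move=> k0 mf f0; have [+ _] := pv k0; move=> ->//.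
apply: ge0_integral_density => //.
- exact: measurable_rho.
- by move=> t; exact: rho_ge0.
- by case: adm => _ h _; case: (h _ k0).
- exact: measurable_palm_integral.
- by move=> t; exact: integral_ge0.
Qed.

Lemma palm_tshift k t y (f : config -> \bar R) : (0 < k)%N ->
  measurable_fun setT f -> (forall X, 0 <= f X) ->
  \int[palm k (tshift y t)]_X f X = \int[palm k t]_X f (cshift y X).
Proof.
move=> k0 mf f0; have [_ covar] := pv k0.
have my : measurable_fun setT (cshift y : config -> config).
  exact: (measurable_cshift (measurable_cst _) (@measurable_id _ _ _)).
transitivity (\int[pushforward (palm k t) (cshift y : config -> config)]_X f X).
  by apply: eq_measure_integral => A mA _; exact: covar.
by rewrite ge0_integral_pushforward.
Qed.

Lemma tshift_tuple1 (x : E) : [tuple x] = tshift x [tuple vzero].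
Proof.
apply: eq_from_tnth => i; rewrite tnth_mktuple ord1 /=.
by apply: eq_from_tnth => j; rewrite !tnth_mktuple add0r.
Qed.

Lemma vadd0 (x : E) : vadd vzero x = x.
Proof. by apply: eq_from_tnth => j; rewrite !tnth_mktuple add0r. Qed.

Lemma tshift_tuple2 (x y : E) : [tuple x; y] = tshift x [tuple vzero; vsub y x].
Proof.
apply: eq_from_tnth => i; rewrite tnth_mktuple.
by case: i => -[|[|//]] i2; rewrite /tnth/= ?vadd0 ?vsubK.
Qed.

Definition invariant1 (g : E -> config -> \bar R) :=
  forall x y X, g (vadd x y) (cshift y X) = g x X.

(** By covariance, the Palm expectation at x is the one at the origin. *)
Lemma campbell1 a (g : E -> config -> \bar R) :
  measurable_fun setT (fun z : E * config => g z.1 z.2) ->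
  (forall x X, 0 <= g x X) -> invariant1 g ->
  \int[Pr]_w \sum_(x <- cpoints a (P w)) g x (P w) =
  @lebd R d (cube a) * (\int[palm 1 [tuple vzero]]_X g vzero X *
                   (rho 1 [tuple vzero])%:E).
Proof.
move=> mg g0 inv.
pose f (z : 1.-tuple E * config) :=
  (\1_(cube a) (tnth z.1 ord0))%:E * g (tnth z.1 ord0) z.2.
have mt : measurable_fun setT (fun z : 1.-tuple E * config => tnth z.1 ord0).
  exact: (measurableT_comp (measurable_tnth ord0)).
have mf : measurable_fun setT f.
  apply: emeasurable_funM; first exact: measurable_indic_cube.
  have mp : measurable_fun setT
      (fun z : 1.-tuple E * config => (tnth z.1 ord0, z.2)).
    exact: measurable_fun_pair.
  exact: (measurableT_comp mg mp).
have f0 z : 0 <= f z by rewrite mule_ge0// lee_fin.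
transitivity (\int[Pr]_w \esum_(t in distinct_tuples 1 (P w)) f (t, P w)).
  apply: eq_integral => w _.
  by rewrite -(@esum_distinct_tuples1 _ _ (P w) a (fun x => g x (P w))).
rewrite campbell// integral_tuple1; first last.
- by move=> t; rewrite mule_ge0 ?lee_fin ?rho_ge0//; exact: integral_ge0.
- apply: emeasurable_funM; first exact: measurable_palm_integral.
  by apply/measurable_EFinP; exact: measurable_rho.
set c := _ * (rho _ _)%:E.
have c0 : 0 <= c by rewrite mule_ge0 ?lee_fin ?rho_ge0//; exact: integral_ge0.
transitivity (\int[@lebd R d]_x ((\1_(cube a) x)%:E * c)).
  apply: eq_integral => x _; rewrite tshift_tuple1 rho_tshift// palm_tshift//.
  + rewrite /f /c muleA; congr (_ * _); rewrite -tshift_tuple1.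
    rewrite -ge0_integralZl//.
    - apply: eq_integral => X _; rewrite /= tnth0; congr (_ * _).
      by rewrite -{1}(vadd0 x) inv.
    - exact: (measurableT_comp mg (measurable_pair1 vzero)).
  + exact: (measurableT_comp mf (measurable_pair1 _)).
rewrite ge0_integralZr//; first by rewrite integral_indic ?setIT//; exact: measurable_cube.
exact: measurable_indic_cube.
Qed.

Definition invariant2 (h : E -> E -> config -> \bar R) :=
  forall x y u X, h (vadd x u) (vadd y u) (cshift u X) = h x y X.

(** The density E_{0,z}[h(0,z,P)] rho^(2)(0,z) of the pairs with difference
    z, weighted by [h]. *)
Definition pair_density (h : E -> E -> config -> \bar R) (z : E) : \bar R :=
  \int[palm 2 [tuple vzero; z]]_X h vzero z X * (rho 2 [tuple vzero; z])%:E.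

Section campbell2.
Variable h : E -> E -> config -> \bar R.
Hypothesis mh : measurable_fun setT (fun z : 2.-tuple E * config =>
  h (tnth z.1 ord0) (tnth z.1 ord_max) z.2).
Hypothesis h0 : forall x y X, 0 <= h x y X.

Lemma pair_density_ge0 z : 0 <= pair_density h z.
Proof. by rewrite mule_ge0 ?lee_fin ?rho_ge0//; exact: integral_ge0. Qed.

Lemma measurable_pair_density : measurable_fun setT (pair_density h).
Proof.
have m2 : measurable_fun setT (fun z : E => [tuple vzero; z]).
  exact: measurable_tuple2.
apply: emeasurable_funM.
  exact: (measurableT_comp (measurable_palm_integral mh (fun=> h0 _ _ _)) m2).
apply/measurable_EFinP.
exact: (measurableT_comp (@measurable_rho 2 isT) m2).
Qed.

Hypothesis inv : invariant2 h.

Lemma palm2_shift x y :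
  \int[palm 2 [tuple x; y]]_X h x y X * (rho 2 [tuple x; y])%:E =
  pair_density h (vsub y x).
Proof.
rewrite tshift_tuple2 rho_tshift// palm_tshift//.
- congr (_ * _); apply: eq_integral => X _.
  by rewrite -{1}(vadd0 x) -{1}(vsubK y x) inv.
- exact: (measurableT_comp mh (measurable_pair1 [tuple x; y])).
Qed.

(** By covariance, the Palm expectation at (x, y) depends on y - x only, so
    that integrating over x leaves the volume of the overlap. *)
Lemma campbell2 a :
  \int[Pr]_w \sum_(x <- cpoints a (P w))
    \sum_(y <- cpoints a (P w) | y != x) h x y (P w) =
  \int[lebd]_z (overlap a z * pair_density h z).
Proof.
pose f (z : 2.-tuple E * config) :=
  (\1_(cube a) (tnth z.1 ord0) * \1_(cube a) (tnth z.1 ord_max))%:E *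
  h (tnth z.1 ord0) (tnth z.1 ord_max) z.2.
have mt i : measurable_fun setT (fun z : 2.-tuple E * config => tnth z.1 i).
  exact: (measurableT_comp (measurable_tnth i)).
have mf : measurable_fun setT f.
  by apply: emeasurable_funM => //; exact: measurable_indic_cube2.
have f0 z : 0 <= f z by rewrite mule_ge0// indic_cube2_ge0.
transitivity (\int[Pr]_w \esum_(t in distinct_tuples 2 (P w)) f (t, P w)).
  apply: eq_integral => w _.
  by rewrite -(@esum_distinct_tuples2 _ _ (P w) a (fun x y => h x y (P w))).
rewrite campbell// integral_tuple2; first last.
- by move=> t; rewrite mule_ge0 ?lee_fin ?rho_ge0//; exact: integral_ge0.
- apply: emeasurable_funM; first exact: measurable_palm_integral.
  by apply/measurable_EFinP; exact: measurable_rho.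
rewrite -integral_cube_diff; first last.
- exact: pair_density_ge0.
- exact: measurable_pair_density.
apply: eq_integral => x _; apply: eq_integral => y _.
rewrite -palm2_shift muleA; congr (_ * _).
rewrite -ge0_integralZl//.
exact: (measurableT_comp mh (measurable_pair1 [tuple x; y])).
Qed.

End campbell2.

End campbell.

(** * Volume of the overlap of translated cubes *)
Section defect.
Context {R : realType}.
Local Open Scope ring_scope.

(** If independent events have probabilities u_i, their union has probability
    1 - prod_i (1 - u_i), and these are weak forms of Bonferroni's inequalities. *)
Lemma prod_onem_bounds (I : Type) (s : seq I) (u : I -> R) :
  (forall i, 0 <= u i <= 1) ->
  [/\ 0 <= \prod_(i <- s) (1 - u i) <= 1,
      1 - \prod_(i <- s) (1 - u i) <= \sum_(i <- s) u i &
      \sum_(i <- s) u i - (\sum_(i <- s) u i) ^+ 2 <=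
      1 - \prod_(i <- s) (1 - u i)].
Proof.
move=> u01; elim: s => [|i s]; first by rewrite !big_nil; split; lra.
rewrite !big_cons; have /andP[] := u01 i.
have : 0 <= \sum_(j <- s) u j by apply: sumr_ge0 => j _; have /andP[] := u01 j.
move: (\prod_(j <- s) _) (\sum_(j <- s) _) (u i) => p S v S0 v0 v1.
case=> /andP[p0 p1] ub lb; split; nra.
Qed.

End defect.

Section volumes.
Context {R : realType} {d : nat}.
Local Notation E := (Rd R d).

Definition overlap_length (a z : R) : R := (Num.max 0 (2 * a - `|z|))%R.

Lemma integral_interval_shift (a z : R) : (0 <= a)%R ->
  \int[lebesgue_measure]_x
    (\1_(`[(- a)%R, a]%classic) x * \1_(`[(- a)%R, a]%classic) (z + x)%R)%:E =
  (overlap_length a z)%:E.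
Proof.
move=> a0.
transitivity (\int[lebesgue_measure]_x
    (\1_(`[Num.max (- a) (- a - z)%R, Num.min a (a - z)%R]%classic) x)%:E).
  apply: eq_integral => x _; rewrite !indicE -natrM mulnb; congr (_%:R%:E).
  congr nat_of_bool; apply/andP/idP.
    move=> [/set_mem /= + /set_mem /=]; rewrite !in_itv/= => h1 h2.
    by apply/mem_set; rewrite /= in_itv/= ge_max le_min; lra.
  move=> /set_mem/=; rewrite in_itv/= ge_max le_min => h.
  by split; apply/mem_set; rewrite /= in_itv/=; lra.
rewrite integral_indic // setIT /= lebesgue_measure_itv/= lte_fin gt_max !lt_min /overlap_length.
have [z0|z0] := leP 0%R z.
  rewrite (ger0_norm z0).
  case: ifPn => h.
    rewrite -EFinB; congr EFin.
    rewrite (max_l (x := (- a)%R))//; last by lra.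
    rewrite (min_r (x := a))//; last by lra.
    by rewrite max_r; lra.
  by rewrite max_l//; lra.
rewrite (ltr0_norm z0).
case: ifPn => h.
  rewrite -EFinB; congr EFin.
  rewrite (max_r (x := (- a)%R))//; last by lra.
  rewrite (min_l (x := a))//; last by lra.
  by rewrite max_r; lra.
by rewrite max_l//; lra.
Qed.

Definition cube_overlap (a : R) (z : E) : R := (\prod_(i < d) overlap_length a (tnth z i))%R.

Lemma indic_cube (a : R) (x : E) :
  \1_(cube a) x = (\prod_(i < d) \1_(`[(- a)%R, a]%classic) (tnth x i : R))%R :> R.
Proof.
rewrite indicE; have [/set_mem ax|/negP nax] /= := boolP (x \in cube a).
  by rewrite big1// => i _; rewrite indicE mem_set//= in_itv/=; exact: ax.
have [i nai] : exists i, ~ (- a <= (tnth x i : R) <= a)%R.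
  by apply: contra_notP nax => h; apply/mem_set => i; apply: contrapT => nai;
    apply: h; exists i.
by rewrite (bigD1 i)//= indicE memNset ?mul0r//= in_itv.
Qed.

Lemma overlapE (a : R) (z : E) : (0 <= a)%R -> overlap a z = (cube_overlap a z)%:E.
Proof.
move=> a0; rewrite /cube_overlap -prodEFin.
under eq_bigr do rewrite -integral_interval_shift//.
have m1 : measurable_fun setT (\1_(`[(- a)%R, a]%classic) : measurableTypeR R -> R).
  exact: measurable_indic.
rewrite -(@integral_tuple_prod _ (measurableTypeR R) _ lebesgue_measure d (fun i x =>
  (\1_(`[(- a)%R, a]%classic) x * \1_(`[(- a)%R, a]%classic) ((tnth z i : R) + x)%R)%:E)).
- apply: eq_integral => x _; rewrite prodEFin big_split/= !indic_cube.
  by congr ((_ * _)%:E); apply: eq_bigr => i _; rewrite tnth_mktuple.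
- move=> i; apply/measurable_EFinP; apply: measurable_funM => //.
  by apply: (measurableT_comp m1); exact: measurable_funD.
- by move=> i x; rewrite lee_fin mulr_ge0.
Qed.

Lemma lebd_cube (a : R) : (0 <= a)%R -> @lebd R d (cube a) = ((2 * a) ^+ d)%R%:E.
Proof.
move=> a0; transitivity (overlap a (@vzero R d)).
  rewrite -[cube a]setIT -integral_indic//; last exact: measurable_cube.
  by apply: eq_integral => x _; rewrite vadd0 indicE;
    case: (x \in cube a); rewrite ?mulr1// mulr0.
rewrite overlapE// /cube_overlap; congr EFin.
under eq_bigr do rewrite tnth_mktuple /overlap_length normr0 subr0 max_r ?mulr_ge0//.
by rewrite prodr_const card_ord.
Qed.

Lemma gammaW_cube (a : R) (z : E) : (0 <= a)%R ->
  gammaW (cube a) z = ((2 * a) ^+ d - cube_overlap a z)%R%:E.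
Proof.
move=> a0.
pose V := [set x : E | cube a (vadd z x)].
have mV : measurable V.
  rewrite -[X in measurable X]setTI.
  apply: (measurable_vadd (measurable_cst z) (@measurable_id _ _ _)) => //.
  exact: measurable_cube.
have mC := @measurable_cube R d a.
have VE : @lebd R d (cube a `&` V) = (cube_overlap a z)%:E.
  rewrite -overlapE// -[cube a `&` V]setIT -integral_indic//; last exact: measurableI.
  apply: eq_integral => x _; rewrite !indicE -natrM mulnb in_setI.
  by congr ((_ && _)%:R%:E); apply/idP/idP => /set_mem h; exact/mem_set.
rewrite /gammaW (_ : [set _ | _ in _] = ~` V); last first.
  apply/seteqP; split => x /=.
    move=> [y ny <-]; apply: contra_not ny; rewrite /V/=.
    rewrite (_ : vadd z (vsub y z) = y)//.
    by apply: eq_from_tnth => i; rewrite !tnth_mktuple addrC subrK.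
  move=> nx; exists (vadd z x) => //.
  by apply: eq_from_tnth => i; rewrite !tnth_mktuple addrC addKr.
rewrite -setDE measureD//.
  by rewrite [X in X - _](lebd_cube a0) [X in _ - X]VE.
by rewrite [X in (X < _)%E](lebd_cube a0) ltry.
Qed.

Definition ell1 (z : E) : R := (\sum_(i < d) `|tnth z i : R|)%R.

Lemma ell1_ge0 z : (0 <= ell1 z)%R.
Proof. exact: sumr_ge0. Qed.

Lemma cube_overlap_ge0 a z : (0 <= cube_overlap a z)%R.
Proof. by apply: prodr_ge0 => i _; rewrite le_max lexx. Qed.

(** The share of the side of the cube that a shift by z uncovers in direction
    i, at most 1. *)
Let frac (L : R) (z : E) (i : 'I_d) : R := (Num.min 1 (`|tnth z i : R| / L))%R.

Lemma cube_overlap_frac (L : R) (z : E) : (0 < L)%R ->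
  cube_overlap (L / 2) z = (L ^+ d * \prod_(i < d) (1 - frac L z i))%R.
Proof.
move=> L0; rewrite /cube_overlap -[X in (L ^+ X)%R]card_ord -prodr_const -big_split/=.
apply: eq_bigr => i _; rewrite /overlap_length /frac.
have -> : (2 * (L / 2) = L)%R by field.
rewrite mulrBr mulr1 minEle; case: ifPn => h.
  move: h; rewrite ler_pdivlMr// mul1r => h.
  by rewrite max_l ?mulr1 ?subrr//; lra.
move: h; rewrite -ltNge ltr_pdivrMr// mul1r => h.
rewrite max_r; last by lra.
by congr (_ - _)%R; rewrite mulrC divfK// gt_eqF.
Qed.

Let frac01 (L : R) (z : E) i : (0 < L)%R -> (0 <= frac L z i <= 1)%R.
Proof. by move=> L0; rewrite /frac ge_min lexx/= le_min ler01 divr_ge0// ltW. Qed.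

Let sum_frac_le (L : R) (z : E) : (0 < L)%R ->
  (\sum_(i < d) frac L z i <= ell1 z / L)%R.
Proof.
move=> L0; rewrite /ell1 mulr_suml; apply: ler_sum => i _.
by rewrite ge_min lexx orbT.
Qed.

Lemma cube_overlap_le (L : R) (z : E) : (0 < L)%R -> (cube_overlap (L / 2) z <= L ^+ d)%R.
Proof.
move=> L0; rewrite cube_overlap_frac//.
have [/andP[_ p1] _ _] := prod_onem_bounds (index_enum 'I_d) (fun i => frac01 z i L0).
by rewrite ler_piMr// exprn_ge0// ltW.
Qed.

Lemma overlap_defect_le (L : R) (z : E) : (0 < L)%R -> (0 < d)%N ->
  (L ^+ d - cube_overlap (L / 2) z <= L ^+ d.-1 * ell1 z)%R.
Proof.
move=> L0 d0; rewrite cube_overlap_frac// -[X in (X - _)%R]mulr1 -mulrBr.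
have [_ ub _] := prod_onem_bounds (index_enum 'I_d) (fun i => frac01 z i L0).
rewrite -{1}(prednK d0) exprSr -mulrA ler_pM2l ?exprn_gt0// mulrC.
by rewrite -ler_pdivlMr// (le_trans ub)// sum_frac_le.
Qed.

(** The shift by z uncovers a slab of thickness |z_i| along each face
    orthogonal to the i-th axis, and the slabs meet in volume O(L^(d-2)). *)
Lemma cvg_overlap_defect (L : nat -> R) (z : E) : (0 < d)%N -> L n @[n --> \oo] --> +oo%R ->
  ((L n ^+ d - cube_overlap (L n / 2) z) / L n ^+ d.-1)%R @[n --> \oo] --> ell1 z.
Proof.
move=> d0 Loo.
have Linf : (ell1 z - ell1 z ^+ 2 * (L n)^-1)%R @[n --> \oo] --> ell1 z.
  rewrite -[X in _ --> X]subr0; apply: cvgB; first exact: cvg_cst.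
  rewrite -[X in _ --> X](mulr0 (ell1 z ^+ 2)%R); apply: cvgMl_tmp.
  by apply/gtr0_cvgV0 => //; exact: (cvgry_gt Loo).
apply: (squeeze_cvgr _ Linf (cvg_cst _)); near=> n.
have L0 : (0 < L n)%R by near: n; exact: (cvgry_gt Loo).
have Lz : (ell1 z < L n)%R by near: n; exact: (cvgry_gt Loo).
apply/andP; split; last by rewrite ler_pdivrMr ?exprn_gt0// [leRHS]mulrC overlap_defect_le.
rewrite cube_overlap_frac//.
rewrite ler_pdivlMr ?exprn_gt0//.
have -> : (L n ^+ d - L n ^+ d * \prod_(i < d) (1 - frac (L n) z i) =
   L n ^+ d * (1 - \prod_(i < d) (1 - frac (L n) z i)))%R by ring.
have Ld : (L n ^+ d = L n ^+ d.-1 * L n)%R by rewrite -exprSr prednK.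
rewrite Ld -mulrA [leLHS]mulrC ler_pM2l ?exprn_gt0//.
have [_ _] := prod_onem_bounds (index_enum 'I_d) (fun i => frac01 z i L0).
have -> : (\sum_(i < d) frac (L n) z i = ell1 z / L n)%R.
  rewrite /ell1 mulr_suml; apply: eq_bigr => i _; rewrite /frac min_r//.
  rewrite ler_pdivrMr// mul1r (le_trans _ (ltW Lz))//.
  by rewrite /ell1 (bigD1 i)//= lerDl sumr_ge0.
rewrite -(ler_pM2l L0); apply: le_trans.
rewrite le_eqVlt; apply/orP; left; apply/eqP; field.
by rewrite gt_eqF.
Unshelve. all: by end_near. Qed.

Lemma cvg_cube_overlap (L : nat -> R) (z : E) : (0 < d)%N -> L n @[n --> \oo] --> +oo%R ->
  (cube_overlap (L n / 2) z / L n ^+ d)%R @[n --> \oo] --> (1 : R)%R.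
Proof.
move=> d0 Loo.
have Linf : (1 - ell1 z * (L n)^-1)%R @[n --> \oo] --> (1 : R)%R.
  rewrite -[X in _ --> X]subr0; apply: cvgB; first exact: cvg_cst.
  rewrite -[X in _ --> X](mulr0 (ell1 z)); apply: cvgMl_tmp.
  by apply/gtr0_cvgV0 => //; exact: (cvgry_gt Loo).
apply: (squeeze_cvgr _ Linf (cvg_cst _)); near=> n.
have L0 : (0 < L n)%R by near: n; exact: (cvgry_gt Loo).
apply/andP; split; last by rewrite ler_pdivrMr ?exprn_gt0// mul1r cube_overlap_le.
rewrite ler_pdivlMr ?exprn_gt0//.
have := overlap_defect_le z L0 d0.
have Ld : (L n ^+ d = L n ^+ d.-1 * L n)%R by rewrite -exprSr prednK.
have -> : ((1 - ell1 z * (L n)^-1) * L n ^+ d =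
  L n ^+ d - L n ^+ d.-1 * ell1 z)%R.
  by rewrite Ld; field; rewrite gt_eqF.
lra.
Unshelve. all: by end_near. Qed.

Definition window_side (n : nat) : R := (n%:R `^ d%:R^-1)%R.

Lemma window_side_ge0 n : (0 <= window_side n)%R. Proof. exact: powR_ge0. Qed.

Lemma window_side_gt0 n : (0 < n)%N -> (0 < window_side n)%R.
Proof. by move=> n0; apply: powR_gt0; rewrite ltr0n. Qed.

Lemma windowE n : window (Some n) = cube (window_side n / 2) :> set E.
Proof. by []. Qed.

Section pos_dim.
Hypothesis d0 : (0 < d)%N.

Lemma window_side_exp n : (window_side n ^+ d = n%:R)%R.
Proof.
rewrite -powR_mulrn ?window_side_ge0// /window_side -powRrM mulVf ?powRr1//.
by rewrite pnatr_eq0 -lt0n.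
Qed.

Lemma cvg_window_side : window_side n @[n --> \oo] --> +oo%R.
Proof.
apply/cvgryPge => A; near=> n.
apply: (@le_trans _ _ (Num.max A 0)%R); first by rewrite le_max lexx.
rewrite -(ler_pXn2r d0) ?nnegrE ?window_side_ge0 ?le_max ?lexx ?orbT// window_side_exp.
by near: n; apply: nbhs_infty_ger.
Unshelve. all: by end_near. Qed.

Lemma window_side_boundary n : (0 < n)%N ->
  (n%:R `^ (- boundary_exponent R d) = (window_side n ^+ d.-1)^-1)%R.
Proof.
move=> n0; rewrite powRN; congr (_^-1)%R.
rewrite -powR_mulrn ?window_side_ge0// /window_side -powRrM /boundary_exponent; congr (_ `^ _)%R.
rewrite [RHS]mulrC; congr (_ / _)%R.
by rewrite -subn1 natrB.
Qed.

Lemma gammaE (z : E) : gamma z = (ell1 z)%:E.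
Proof.
apply: cvg_lim => //.
apply: (@cvg_trans _
  ((((window_side n ^+ d - cube_overlap (window_side n / 2) z) / window_side n ^+ d.-1)%R)%:E @[n --> \oo])).
  apply: near_eq_cvg; near=> n.
  have n0 : (0 < n)%N by near: n; exact: nbhs_infty_gt.
  rewrite windowE gammaW_cube ?divr_ge0 ?window_side_ge0// window_side_boundary// EFinM.
  by congr ((_ - _)%R%:E * _); congr (_ ^+ _)%R; field.
by apply/cvg_EFin; [exact: nearW|exact: cvg_overlap_defect cvg_window_side].
Unshelve. all: by end_near. Qed.

End pos_dim.

End volumes.
Arguments window_side R d n : clear implicits.
Arguments window_side_gt0 R d {n}.

(** * An integrable majorant of fast decreasing functions *)
Section majorant.
Context {R : realType} {d : nat}.
Local Notation E := (Rd R d).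

(** A product of functions of one coordinate, so that its integral is a power
    of the integral of 1/(1 + x^2). *)
Definition majorant (z : E) : R := (\prod_(i < d) (oneDsqr (tnth z i : R))^-1)%R.

Lemma majorant_gt0 z : (0 < majorant z)%R.
Proof. by apply: prodr_gt0 => i _; rewrite invr_gt0 (lt_le_trans ltr01)// oneDsqr_ge1. Qed.

Lemma measurable_oneDsqrV :
  measurable_fun setT ((fun x => (oneDsqr x)^-1)%R : measurableTypeR R -> R).
Proof. by apply: continuous_measurable_fun; exact: continuous_oneDsqrV. Qed.

Lemma measurable_majorant : measurable_fun setT (fun z : E => (majorant z)%:E).
Proof.
apply/measurable_EFinP; apply: measurable_prod => i _.
by apply: (measurableT_comp measurable_oneDsqrV); exact: measurable_coord.
Qed.

Lemma integral_oneDsqrV :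
  \int[@lebesgue_measure R]_x ((oneDsqr x)^-1)%:E = pi%:E.
Proof.
rewrite ge0_symfun_integralT//.
- by rewrite -set_itvcy integral0y_oneDsqr -EFinM; congr EFin; field.
- exact: continuous_oneDsqrV.
- by move=> x /=; rewrite /oneDsqr sqrrN.
Qed.

Lemma integral_majorant : \int[@lebd R d]_z (majorant z)%:E = (pi ^+ d)%R%:E.
Proof.
transitivity (\prod_(i < d) \int[@lebesgue_measure R]_x ((oneDsqr x)^-1)%:E).
  rewrite -(@integral_tuple_prod _ (measurableTypeR R) _ lebesgue_measure d
    (fun _ x => ((oneDsqr x)^-1)%:E)).
  - by apply: eq_integral => z _; rewrite prodEFin.
  - by move=> i; apply/measurable_EFinP; exact: measurable_oneDsqrV.
  - by move=> i x; rewrite lee_fin invr_ge0 (le_trans ler01)// oneDsqr_ge1.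
under eq_bigr do rewrite integral_oneDsqrV.
by rewrite prodEFin prodr_const card_ord.
Qed.

Lemma enorm_ge0 (z : E) : (0 <= enorm z)%R.
Proof. exact: sqrtr_ge0. Qed.

Lemma sqr_coord_le (z : E) i : ((tnth z i : R) ^+ 2 <= enorm z ^+ 2)%R.
Proof.
rewrite sqr_sqrtr; last by apply: sumr_ge0 => j _; exact: sqr_ge0.
by rewrite (bigD1 i)//= lerDl sumr_ge0// => j _; exact: sqr_ge0.
Qed.

Lemma coord_le (z : E) i : (`|tnth z i : R| <= enorm z)%R.
Proof.
rewrite -(@ler_pXn2r _ 2) ?nnegrE ?enorm_ge0// -normrX ger0_norm ?sqr_ge0//.
exact: sqr_coord_le.
Qed.

(** The decay bounds the product for large r, and phi <= 1 for bounded r. *)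
Lemma fast_decreasing_poly (phi : R -> R) (c : R) m : fast_decreasing phi -> (0 < c)%R ->
  exists2 K : R, (0 <= K)%R & forall r, (0 <= r)%R -> ((1 + r) ^+ m * phi (c * r) <= K)%R.
Proof.
move=> [phi01 _ phi_oo] c0.
have /cvgrPdist_lt/(_ 1%R ltr01) [A [_ hA]] := phi_oo m.+1 isT.
have [B [BA cB B1]] : exists B : R, [/\ A <= B, c <= B & 1 <= B]%R.
  by exists (Num.max A (Num.max c 1))%R; rewrite !le_max !lexx !orbT.
have c2 : (0 <= 2 / c)%R by rewrite divr_ge0// ltW.
have Bc : (0 <= 1 + B / c)%R by rewrite addr_ge0// divr_ge0 ?ltW//; lra.
exists ((2 / c) ^+ m + (1 + B / c) ^+ m)%R; first by rewrite addr_ge0// exprn_ge0.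
move=> r r0.
have t0 : (0 <= c * r)%R by rewrite mulr_ge0// ltW.
have /andP[p0 p1] := phi01 _ t0.
have [tB|Bt] := leP (c * r)%R B.
  apply: (@le_trans _ _ ((1 + B / c) ^+ m * 1)%R); last first.
    by rewrite mulr1 lerDr exprn_ge0.
  apply: ler_pM => //; first by rewrite exprn_ge0//; lra.
  rewrite lerXn2r ?nnegrE//; first by lra.
  by rewrite lerD2l ler_pdivlMr// mulrC.
apply: (@le_trans _ _ ((2 / c) ^+ m * ((c * r) ^+ m * phi (c * r)))%R).
  rewrite mulrA -exprMn; apply: ler_wpM2r => //.
  have -> : (2 / c * (c * r) = 2 * r)%R by field; rewrite gt_eqF.
  have : (1 <= r)%R by rewrite -(ler_pM2l c0) mulr1; lra.
  by move=> r1; rewrite lerXn2r ?nnegrE//; lra.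
rewrite -[X in (X <= _)%R]addr0; apply: lerD; last by rewrite exprn_ge0.
rewrite -[leRHS]mulr1 ler_wpM2l ?exprn_ge0//.
have /= := hA (c * r)%R (le_lt_trans BA Bt); rewrite sub0r normrN => h.
apply: le_trans (ltW h); rewrite ger0_norm; last by rewrite mulr_ge0// exprn_ge0.
by apply: ler_wpM2r => //; rewrite exprS ler_peMl ?exprn_ge0//; lra.
Qed.

(** The quotient of 1 + |z|_1 by the majorant is at most a multiple of
    (1 + |z|)^(2d+1), which [phi] absorbs. The factor 1 + |z|_1 makes the bound
    strong enough for the weight gamma. *)
Lemma fast_decreasing_majorant (phi : R -> R) (c : R) :
  fast_decreasing phi -> (0 < c)%R ->
  exists2 K : R, (0 <= K)%R & forall z : E,
    ((1 + ell1 z) * phi (c * enorm z) <= K * majorant z)%R.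
Proof.
move=> fphi c0.
have [K K0 hK] := fast_decreasing_poly (2 * d).+1 fphi c0.
exists (d.+1%:R * K)%R; first by rewrite mulr_ge0.
move=> z; set r := enorm z; have r0 : (0 <= r)%R := enorm_ge0 z.
have [phi01 _ _] := fphi.
have /andP[p0 p1] : (0 <= phi (c * r) <= 1)%R by apply: phi01; rewrite mulr_ge0// ltW.
have e1 : (1 + ell1 z <= d.+1%:R * (1 + r))%R.
  have : (ell1 z <= d%:R * r)%R.
    rewrite mulr_natl -[X in (_ *+ X)%R]card_ord -sumr_const.
    by apply: ler_sum => i _; exact: coord_le.
  rewrite -natr1; have : (0 <= d%:R :> R)%R by [].
  nra.
have e2 : ((majorant z)^-1 <= (1 + r) ^+ (2 * d))%R.
  rewrite /majorant -prodfV exprM -[X in (_ ^+ X)%R]card_ord -prodr_const.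
  apply: ler_prod => i _; rewrite invrK (le_trans ler01 (oneDsqr_ge1 _))/= /oneDsqr.
  have := sqr_coord_le z i; rewrite -/r; nra.
rewrite -ler_pdivrMr ?majorant_gt0//.
apply: (@le_trans _ _ ((d.+1%:R * (1 + r)) * phi (c * r) * (1 + r) ^+ (2 * d))%R).
  apply: ler_pM => //.
  - by rewrite mulr_ge0// addr_ge0// ell1_ge0.
  - by rewrite invr_ge0 ltW// majorant_gt0.
  - exact: ler_wpM2r.
apply: (le_trans _ (ler_wpM2l (ler0n _ d.+1) (hK _ r0))).
rewrite exprS le_eqVlt; apply/orP; left; apply/eqP; ring.
Qed.

End majorant.

(** * Almost every pair and almost every difference *)
Section ae_difference.
Context {R : realType} {d : nat}.
Local Notation E := (Rd R d).

Lemma lebd_setT_gt0 : 0 < @lebd R d setT.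
Proof.
apply: (@lt_le_trans _ _ (@lebd R d (cube 1%R))).
  by rewrite [X in _ < X](lebd_cube (@ler01 R)) lte_fin exprn_gt0// mulr1.
by apply: le_measure; rewrite ?inE//; exact: measurable_cube.
Qed.

Lemma lebd_not_null (Q : E -> Prop) : (\forall x \ae lebd, Q x) -> exists x, Q x.
Proof.
move=> [A [mA A0 sub]]; apply: contrapT => h.
have AT : A = setT.
  rewrite -subTset => x _; apply: sub => Qx.
  by apply: h; exists x.
by have := lebd_setT_gt0; rewrite -AT A0 ltxx.
Qed.

(** Almost every section of a null set of pairs is null. For one x with a
    null section, the exceptional differences lie in that section shifted
    by -x. *)
Lemma ae_pair_diff (Q : E -> Prop) :
  (\forall z \ae lebdk 2, Q (vsub (tnth z ord_max) (tnth z ord0))) ->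
  \forall y \ae @lebd R d, Q y.
Proof.
move=> [A [mA A0 sub]].
have mt2 (x : E) : measurable_fun setT (fun y : E => [tuple x; y]).
  exact: measurable_tuple2.
have m1A : measurable_fun setT (fun t : 2.-tuple E => (\1_A t)%:E : \bar R).
  by apply/measurable_EFinP; exact: measurable_indic.
have A0' : \int[lebd]_x \int[lebd]_y (\1_A [tuple x; y])%:E = 0 :> \bar R.
  rewrite -(@integral_tuple2 _ _ _ lebd (fun t => (\1_A t)%:E))//.
  transitivity (lebdk 2 (A `&` setT)); last by rewrite setIT.
  exact: (integral_indic (lebdk 2) measurableT mA).
have mg : measurable_fun setT
    (fun x : E => \int[lebd]_y (\1_A [tuple x; y])%:E : \bar R).
  apply: (@measurable_fun_integral_r _ _ _ lebd
    (fun z => (\1_A [tuple z.1; z.2])%:E)) => //.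
  apply: (measurableT_comp m1A); exact: measurable_tuple2.
have g0 x : 0 <= \int[@lebd R d]_y (\1_A [tuple x; y])%:E :> \bar R.
  by apply: integral_ge0 => y _; rewrite lee_fin.
have [x xA] : exists x, \int[@lebd R d]_y (\1_A [tuple x; y])%:E = 0 :> \bar R.
  apply: lebd_not_null.
  have [+ _] := @ae_eq_integral_abs _ _ _ (@lebd R d) setT measurableT _ mg.
  move=> ae0; have gz : \int[@lebd R d]_x
      `|\int[@lebd R d]_y (\1_A [tuple x; y])%:E| = 0 :> \bar R.
    by rewrite -[RHS]A0'; apply: eq_integral => x _; rewrite gee0_abs.
  by apply: filterS (ae0 gz) => x; exact.
pose B := [set z : E | A [tuple x; vadd z x]].
have mB : measurable B.
  rewrite -[X in measurable X]setTI.
  apply: (measurableT_comp (mt2 x)) => //.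
  by apply: measurable_vadd.
exists B; split => //.
  transitivity (\int[@lebd R d]_z (\1_A [tuple x; vadd z x])%:E : \bar R).
    transitivity (\int[@lebd R d]_z (\1_B z)%:E : \bar R).
      by rewrite (integral_indic lebd measurableT mB) setIT.
    apply: eq_integral => z _; rewrite !indicE; congr ((nat_of_bool _)%:R%:E).
  rewrite -[RHS]xA (@ge0_integral_lebdD _ _ x (fun y => (\1_A [tuple x; y])%:E))//.
  exact: (measurableT_comp m1A).
move=> y nQ; apply: sub => /=.
by rewrite /tnth/= vaddK.
Qed.

End ae_difference.

(** * Dominated convergence *)
Section dominated.
Context {R : realType} {d : nat}.
Local Notation E := (Rd R d).
Variables (f : E -> R) (K : R).
Hypotheses (d0 : (0 < d)%N) (mf : measurable_fun setT f).
Hypothesis fK : \forall z \ae lebd, ((1 + ell1 z) * `|f z| <= K * majorant z)%R.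

Lemma integrable_majorant :
  (@lebd R d).-integrable setT (fun z => (K * majorant z)%:E).
Proof.
under eq_fun do rewrite EFinM.
apply: integrableZl => //; apply/integrableP; split; first exact: measurable_majorant.
under eq_integral do rewrite gee0_abs ?lee_fin ?ltW ?majorant_gt0//.
by rewrite integral_majorant ltry.
Qed.

Lemma measurable_ell1 : measurable_fun setT (@ell1 R d).
Proof.
apply: measurable_sum => i.
by apply: measurableT_comp => //; exact: measurable_coord.
Qed.

Lemma measurable_cube_overlap a : measurable_fun setT (@cube_overlap R d a).
Proof.
apply: measurable_prod => i _; apply: measurable_maxr => //.
apply: measurable_funB => //.
by apply: measurableT_comp => //; exact: measurable_coord.
Qed.

(** Meant for two weights bounded by 1 + |z|_1: the volume of the overlap
    divided by n, and its distance to n divided by L^(d-1). *)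
Lemma dominated_weight (w : nat -> E -> R) (W : E -> R) :
  (forall n, measurable_fun setT (w n)) -> measurable_fun setT W ->
  (forall z, w n z @[n --> \oo] --> W z) ->
  (forall n z, `|w n z| <= 1 + ell1 z)%R ->
  (@lebd R d).-integrable setT (fun z => (W z * f z)%:E) /\
  \int[lebd]_z (w n z * f z)%:E @[n --> \oo] --> \int[lebd]_z (W z * f z)%:E.
Proof.
move=> mw mW wW wb.
have [] := @dominated_convergence _ _ _ lebd setT measurableT
  (fun n z => (w n z * f z)%:E) (fun z => (W z * f z)%:E)
  (fun z => (K * majorant z)%:E).
- by move=> n; apply/measurable_EFinP; exact: measurable_funM.
- by apply/measurable_EFinP; exact: measurable_funM.
- apply: aeW => z _; apply/cvg_EFin; first exact: nearW.
  by apply: cvgMr_tmp; exact: wW.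
- exact: integrable_majorant.
- apply: filterS fK => z fz n _; rewrite /= lee_fin normrM.
  by apply: le_trans fz; apply: ler_wpM2r.
by move=> intW _ cvg; split.
Qed.

Lemma cvg_integral_overlap :
  (@lebd R d).-integrable setT (fun z => (f z)%:E) /\
  \int[lebd]_z (cube_overlap (window_side R d n / 2) z / n%:R * f z)%:E @[n --> \oo] -->
  \int[lebd]_z (f z)%:E.
Proof.
have -> : (fun z => (f z)%:E) = (fun z => (cst 1%R z * f z)%:E) :> (E -> \bar R).
  by apply/funext => z; rewrite mul1r.
apply: dominated_weight => //.
- by move=> n; apply: measurable_funM => //; exact: measurable_cube_overlap.
- move=> z; under eq_fun => n do rewrite -(@window_side_exp R d d0 n).
  by apply: cvg_cube_overlap => //; exact: cvg_window_side.
- move=> n z; rewrite ger0_norm; last by rewrite divr_ge0// cube_overlap_ge0.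
  apply: (@le_trans _ _ 1%R); last by rewrite lerDl ell1_ge0.
  have [->|n0] := posnP n; first by rewrite invr0 mulr0.
  by rewrite ler_pdivrMr ?ltr0n// mul1r -(@window_side_exp R d d0 n) cube_overlap_le// window_side_gt0.
Qed.

Lemma cvg_integral_defect :
  (@lebd R d).-integrable setT (fun z => (ell1 z * f z)%:E) /\
  \int[lebd]_z ((n%:R - cube_overlap (window_side R d n / 2) z) / window_side R d n ^+ d.-1 * f z)%:E
    @[n --> \oo] --> \int[lebd]_z (ell1 z * f z)%:E.
Proof.
apply: dominated_weight.
- move=> n; apply: measurable_funM => //; apply: measurable_funB => //.
  exact: measurable_cube_overlap.
- exact: measurable_ell1.
- move=> z; under eq_fun => n do rewrite -(@window_side_exp R d d0 n).
  by apply: cvg_overlap_defect => //; exact: cvg_window_side.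
- move=> n z; have [->|n0] := posnP n.
    have -> : cube_overlap (window_side R d 0 / 2) z = 0%R :> R.
      rewrite /cube_overlap /window_side powR0 ?mul0r; last by rewrite invr_eq0 pnatr_eq0 -lt0n.
      by rewrite (bigD1 (Ordinal d0))//= /overlap_length mulr0 sub0r max_l ?mul0r ?oppr_le0.
    by rewrite subrr mul0r normr0 addr_ge0// ell1_ge0.
  have s0 := window_side_gt0 R d n0.
  rewrite -(@window_side_exp R d d0 n) ger0_norm; last first.
    by apply: divr_ge0; [rewrite subr_ge0 cube_overlap_le|rewrite exprn_ge0 ?ltW].
  rewrite ler_pdivrMr ?exprn_gt0// (le_trans (overlap_defect_le z s0 d0))//.
  by rewrite mulrC ler_wpM2r// ?exprn_ge0// ?ltW// ltrDr.
Qed.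

End dominated.

(** * Off-diagonal sums *)
Section pair_sums.
Context {R : realFieldType} {T : eqType}.
Local Open Scope ring_scope.
Variables (s : seq T) (us : uniq s).

Lemma sum_offdiag (dens : T -> T -> R) :
  \sum_(x <- s) \sum_(y <- s | y != x) dens x y =
  \sum_(x <- s) \sum_(y <- s) dens x y - \sum_(x <- s) dens x x.
Proof.
apply/eqP; rewrite -subr_eq opprK -big_split/= eq_sym; apply/eqP.
rewrite !big_seq; apply: eq_bigr => x xs.
by rewrite (bigD1_seq x)//= addrC.
Qed.

Lemma sqr_sum (a : T -> R) :
  (\sum_(x <- s) a x) ^+ 2 = \sum_(x <- s) \sum_(y <- s) a x * a y.
Proof. by rewrite expr2 mulr_suml; apply: eq_bigr => x _; rewrite mulr_sumr. Qed.

Lemma offdiag_mul (a : T -> R) :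
  \sum_(x <- s) \sum_(y <- s | y != x) a x * a y =
  (\sum_(x <- s) a x) ^+ 2 - \sum_(x <- s) a x ^+ 2.
Proof. by rewrite sum_offdiag -sqr_sum. Qed.

Lemma offdiag_sqr (a : T -> R) :
  \sum_(x <- s) \sum_(y <- s | y != x) a x ^+ 2 =
  (\sum_(x <- s) a x ^+ 2) * (\sum_(x <- s) 1) - \sum_(x <- s) a x ^+ 2.
Proof.
rewrite sum_offdiag; congr (_ - _); rewrite mulr_suml; apply: eq_bigr => x _.
by rewrite mulr_sumr; apply: eq_bigr => y _; rewrite mulr1.
Qed.

(** Since |a b| <= (a^2 + b^2) / 2 and the sum is symmetric in the two
    points, the moments of one point of the pair control the product. *)
Lemma offdiag_norm_le (a : T -> R) :
  \sum_(x <- s) \sum_(y <- s | y != x) `|a x * a y| <=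
  \sum_(x <- s) \sum_(y <- s | y != x) a x ^+ 2.
Proof.
have le2 : \sum_(x <- s) \sum_(y <- s | y != x) `|a x * a y| <=
    \sum_(x <- s) \sum_(y <- s | y != x) ((a x ^+ 2 + a y ^+ 2) / 2).
  apply: ler_sum => x _; apply: ler_sum => y _.
  rewrite normrM -(real_normK (num_real (a x))) -(real_normK (num_real (a y))).
  rewrite ler_pdivlMr//; have := sqr_ge0 (`|a x| - `|a y|); nra.
apply: le_trans le2 _; rewrite le_eqVlt; apply/orP; left; apply/eqP.
rewrite (sum_offdiag (fun x y => (a x ^+ 2 + a y ^+ 2) / 2)).
rewrite (sum_offdiag (fun x _ => a x ^+ 2)).
have -> : \sum_(x <- s) \sum_(y <- s) (a x ^+ 2 + a y ^+ 2) / 2 =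
    \sum_(x <- s) \sum_(y <- s) a x ^+ 2.
  under eq_bigr do under eq_bigr do rewrite mulrDl.
  under eq_bigr do rewrite big_split/=.
  rewrite big_split/= [X in _ + X]exchange_big/= -big_split/=.
  by apply: eq_bigr => x _; rewrite -big_split/=; apply: eq_bigr => y _; field.
by congr (_ - _); apply: eq_bigr => x _; field.
Qed.

Definition pospart (r : R) := Num.max r 0.
Definition negpart (r : R) := Num.max (- r) 0.

(** Through this formula sums of positive parts are polynomials in sums over
    single points, hence measurable; the same holds for negative parts. *)
Lemma pospart_half r : pospart r = (`|r| + r) / 2.
Proof.
by rewrite /pospart; have [r0|r0] := leP 0 r;
  [rewrite ger0_norm//|rewrite ltr0_norm//]; lra.
Qed.

Lemma negpart_half r : negpart r = (`|r| - r) / 2.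
Proof.
by rewrite /negpart; have [r0|r0] := leP 0 r;
  [rewrite ger0_norm// max_r ?oppr_le0//|
   rewrite ltr0_norm// max_l ?oppr_ge0 ?ltW//]; lra.
Qed.

Lemma posneg r : r = pospart r - negpart r.
Proof. rewrite pospart_half negpart_half; lra. Qed.

Lemma pospart_ge0 r : 0 <= pospart r. Proof. by rewrite le_max lexx orbT. Qed.
Lemma negpart_ge0 r : 0 <= negpart r. Proof. by rewrite le_max lexx orbT. Qed.

End pair_sums.

(** * Moments under the Palm laws *)
Section moments.
Context {R : realType} {d : nat} {disp : measure_display}
  {Omega : measurableType disp} {Pr : probability Omega R}.
Local Notation E := (Rd R d).
Local Notation config := (config R d).
Context {P : {mfun Omega >-> config}} {rho : forall k : nat, k.-tuple E -> R}
  {palm : forall k : nat, R.-pker (k.-tuple E) ~> config} {xi : E -> config -> R}.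
Arguments rho : clear implicits.
Hypotheses (adm : admissible Pr P rho) (pv : palm_version Pr P palm).
Hypothesis sc : score_function xi.

Lemma windowed_None (X : config) : windowed None X = X.
Proof.
have config_eq (Y Z : config) : points Y = points Z -> Y = Z.
  case: Y Z => [A lA] [B lB] /= AB; move: lA; rewrite AB => lA.
  by congr Config; exact: Prop_irrelevance.
by apply: config_eq; rewrite /= setIT.
Qed.

Lemma measurable_xi d' (S : measurableType d') (f : S -> E) (Q : S -> config) :
  measurable_fun setT f -> measurable_fun setT Q ->
  measurable_fun setT (fun s => xi (f s) (Q s)).
Proof.
move=> mf mQ.
apply: (measurableT_comp (measurable_score sc) (measurable_fun_pair mf mQ)).
Qed.

Definition capped_moment (p : R) (x : E) (X : config) : \bar R :=
  ((Num.max `|xi x X| 1) `^ p)%:E.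

Lemma capped_moment_ge0 p x X : 0 <= capped_moment p x X.
Proof. by rewrite lee_fin powR_ge0. Qed.

Lemma measurable_capped_moment p d' (S : measurableType d') (f : S -> E) (Q : S -> config) :
  measurable_fun setT f -> measurable_fun setT Q ->
  measurable_fun setT (fun s => capped_moment p (f s) (Q s)).
Proof.
move=> mf mQ; apply/measurable_EFinP.
apply: (measurableT_comp (@measurable_powR R p)).
apply: measurable_maxr => //; apply: measurableT_comp => //.
exact: measurable_xi.
Qed.

(** A null set of the factorial moment measure is a set on which the
    correlation function vanishes Lebesgue almost everywhere. *)
Lemma moment_ae (p : R) (k : nat) : moment_condition xi Pr P palm p ->
  (Posz k.+1 <= Num.floor p)%R ->
  exists2 C : R, (0 <= C)%R & \forall t \ae lebdk k.+1,
    rho k.+1 t = 0%R \/ \int[palm k.+1 t]_X capped_moment p (thead t) X <= C%:E.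
Proof.
move=> mc kp.
set f := fun t : k.+1.-tuple E => \int[palm k.+1 t]_X capped_moment p (thead t) X.
have fE : f = (fun t : k.+1.-tuple E => \int[palm k.+1 t]_X
    ((Num.max `|xi (thead t) (windowed None X)| 1) `^ p)%:E).
  by apply/funext => t; apply: eq_integral => X _; rewrite windowed_None.
have mcN : ess_sup_in (factorial_moment Pr P k.+1) (@tuple_in_window R d None k.+1) f < +oo.
  rewrite fE; apply: le_lt_trans mc.
  apply: le_trans; last first.
    apply: ereal_sup_ubound; exists None; first exact: isT.
    reflexivity.
  apply: ereal_sup_ubound; exists k; first exact: kp.
  reflexivity.
have [M [A [mA A0 sub]] Moo] := ereal_inf_lt mcN.
exists (Num.max (fine M) 0)%R; first by rewrite le_max lexx orbT.
have mrho : measurable_fun setT (rho k.+1) :=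
  measurable_rho adm (ltn0Sn k).
have rhoA0 : \int[lebdk k.+1]_(t in A) `|(rho k.+1 t)%:E| = 0.
  case: adm => _ /(_ k.+1 (ltn0Sn k))[_ rho0 fmE _] _.
  transitivity (\int[lebdk k.+1]_(t in A) (rho k.+1 t)%:E).
    by apply: eq_integral => t _; rewrite /= (ger0_norm (rho0 t)).
  by rewrite -(fmE _ mA); exact: A0.
have mrhoA : measurable_fun A (fun t => (rho k.+1 t)%:E).
  by apply: measurable_funTS; exact/measurable_EFinP.
have [h _] := @ae_eq_integral_abs _ _ _ (@lebdk R d k.+1) A mA _ mrhoA.
apply: filterS (h rhoA0) => t At.
have [tA|tA] := pselect (A t); [left|right].
  by move: (At tA) => /= [].
have fM : f t <= M by apply: (contrapT (contra_not (@sub t) tA)) => i.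
apply: (le_trans fM); case: M Moo {sub fM} => [r _|//|_]; last exact: leNye.
by rewrite lee_fin le_max lexx.
Qed.

Lemma ler_capped_moment (p : R) (x : E) (X : config) (m : nat) : (m <= 2)%N -> (2 < p)%R ->
  (`|xi x X| ^+ m <= Num.max `|xi x X| 1 `^ p)%R.
Proof.
move=> m2 p2; have le1 : (1 <= Num.max `|xi x X| 1)%R by rewrite le_max lexx orbT.
apply: (@le_trans _ _ (Num.max `|xi x X| 1 ^+ m)%R).
  by rewrite lerXn2r ?nnegrE ?(le_trans ler01 le1)// le_max lexx.
rewrite -powR_mulrn ?(le_trans ler01 le1)//; apply: ler_powR => //.
by apply: le_trans (ltW p2); rewrite ler_nat.
Qed.

(** The intensity is positive, and by covariance the moment is the same at
    all points, so the bound at one point gives it at the origin. *)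
Lemma moment1 (p : R) : (2 < p)%R -> moment_condition xi Pr P palm p ->
  \int[palm 1 [tuple vzero]]_X capped_moment p vzero X < +oo.
Proof.
move=> p2 mc.
have fp : (Posz 1 <= Num.floor p)%R by rewrite floor_ge_int; lra.
have [C C0 [A [mA A0 sub]]] := moment_ae mc fp.
have [x xA] : exists x : E, ~ A [tuple x].
  apply: lebd_not_null.
  have mt : measurable_fun setT (fun x : E => [tuple x]) by exact: measurable_tuple1.
  have mB : measurable ((fun x : E => [tuple x]) @^-1` A).
    by rewrite -[X in measurable X]setTI; exact: mt.
  exists ((fun x : E => [tuple x]) @^-1` A); split => //; last by move=> x /contrapT.
  transitivity (\int[@lebd R d]_x (\1_A [tuple x])%:E : \bar R).
    transitivity (\int[@lebd R d]_x (\1_((fun x : E => [tuple x]) @^-1` A) x)%:E : \bar R).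
      by rewrite (integral_indic lebd measurableT mB) setIT.
    by apply: eq_integral => z _; rewrite !indicE; congr ((nat_of_bool _)%:R%:E).
  rewrite -(@integral_tuple1 _ _ _ lebd (fun t => (\1_A t)%:E)).
  - transitivity (lebdk 1 (A `&` setT)); last by rewrite setIT.
    exact: (integral_indic (lebdk 1) measurableT mA).
  - by apply/measurable_EFinP; exact: measurable_indic.
  - by move=> t; rewrite lee_fin.
have alt : rho 1%N [tuple x] = 0%R \/
    \int[palm 1%N [tuple x]]_X capped_moment p x X <= C%:E.
  exact: contrapT (contra_not (@sub [tuple x]) xA).
have inv (X : config) : capped_moment p x (cshift x X) = capped_moment p vzero X.
  by rewrite /capped_moment; case: sc => _ _ _ xiD; rewrite -{1}(vadd0 x) xiD.
case: alt; rewrite tshift_tuple1.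
  by rewrite (rho_tshift adm)// => r0; case: (adm) => _ _; rewrite r0 ltxx.
rewrite (palm_tshift pv)//; first last.
- exact: capped_moment_ge0.
- exact: (measurable_capped_moment p (measurable_cst x) (@measurable_id _ _ _)).
move=> h; apply: le_lt_trans (ltry C); apply: le_trans h.
rewrite le_eqVlt; apply/orP; left; apply/eqP.
by apply: eq_integral => X _; rewrite inv.
Qed.

End moments.

(** * The variance of a sum of scores *)
Section variance.
Context {R : realType} {d : nat} {disp : measure_display}
  {Omega : measurableType disp} {Pr : probability Omega R}.
Local Notation E := (Rd R d).
Local Notation config := (config R d).
Context {P : {mfun Omega >-> config}} {rho : forall k : nat, k.-tuple E -> R}
  {palm : forall k : nat, R.-pker (k.-tuple E) ~> config} {xi : E -> config -> R}.
Arguments rho : clear implicits.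
Hypotheses (adm : admissible Pr P rho) (pv : palm_version Pr P palm).
Hypothesis sc : score_function xi.

Definition mark_sum (a : R) (g : E -> config -> R) (w : Omega) : R :=
  (\sum_(x <- cpoints a (P w)) g x (P w))%R.

Lemma measurable_mark_sum a (g : E -> config -> R) :
  measurable_fun setT (fun z : E * config => g z.1 z.2) ->
  measurable_fun setT (mark_sum a g).
Proof.
move=> mg.
have mP : measurable_fun setT (P : Omega -> config) by exact: measurable_funPT.
have pos (h : E -> config -> R) :
    measurable_fun setT (fun z : E * config => h z.1 z.2) ->
    (forall x X, (0 <= h x X)%R) -> measurable_fun setT (mark_sum a h).
  move=> mh h0; apply/measurable_EFinP.
  rewrite (_ : _ \o _ = fun w => \sum_(x <- cpoints a (P w)) (h x (P w))%:E).
    apply: (@measurable_sum_cpoints _ _ _ Omega P a (fun z => (h z.2 (P z.1))%:E)) => //.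
      apply/measurable_EFinP; apply: (measurableT_comp mh
        (measurable_fun_pair (@measurable_snd _ _ Omega E)
           (measurableT_comp mP (@measurable_fst _ _ Omega E)))).
    by move=> z; rewrite lee_fin.
  by apply/funext => w; rewrite /= sumEFin.
rewrite (_ : mark_sum a g = (fun w => mark_sum a (fun x X => pospart (g x X)) w
    - mark_sum a (fun x X => negpart (g x X)) w)%R).
  apply: measurable_funB; apply: pos => [|x X].
  - exact: measurable_maxr.
  - exact: pospart_ge0.
  - by apply: measurable_maxr => //; exact: measurableT_comp.
  - exact: negpart_ge0.
apply/funext => w; rewrite /mark_sum -sumrB; apply: eq_bigr => x _; exact: posneg.
Qed.

Let mxi := measurable_score sc.

Let xiD x y X : xi (vadd x y) (cshift y X) = xi x X.
Proof. by case: sc. Qed.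

Let mxi2 i : measurable_fun setT (fun z : 2.-tuple E * config => xi (tnth z.1 i) z.2).
Proof.
apply: (measurable_xi sc) => //.
exact: (measurableT_comp (measurable_tnth i)).
Qed.

Definition second_moment : \bar R :=
  \int[palm 1%N [tuple vzero]]_X (xi vzero X ^+ 2)%:E * (rho 1%N [tuple vzero])%:E.

Let mxi0 : measurable_fun setT (xi vzero). Proof. by case: sc. Qed.

Lemma integral_mark_sum_sqr a :
  \int[Pr]_w (mark_sum a (fun x X => xi x X ^+ 2)%R w)%:E = @lebd R d (cube a) * second_moment.
Proof.
rewrite /second_moment -(@campbell1 _ _ _ _ _ _ _ _ adm pv a (fun x X => (xi x X ^+ 2)%:E)).
- by apply: eq_integral => w _; rewrite sumEFin.
- by apply/measurable_EFinP; exact: measurable_funX.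
- by move=> x X; rewrite lee_fin sqr_ge0.
- by move=> x y X; rewrite xiD.
Qed.

Section with_moments.
Variable p : R.
Hypotheses (p2 : (2 < p)%R) (mc : moment_condition xi Pr P palm p).
Hypothesis rho2b : exists M : R, \forall z \ae lebdk 2, (rho 2%N z <= M)%R.

Lemma integrable_xi_palm m : (m <= 2)%N ->
  (palm 1%N [tuple vzero]).-integrable setT (fun X => (xi vzero X ^+ m)%:E).
Proof.
move=> m2; apply/integrableP; split.
  by apply/measurable_EFinP; exact: measurable_funX.
apply: le_lt_trans (moment1 adm pv sc p2 mc).
apply: ge0_le_integral => //.
- by apply: measurableT_comp => //; apply/measurable_EFinP; exact: measurable_funX.
- exact: (measurable_capped_moment sc p (measurable_cst vzero) (@measurable_id _ _ _)).
- by move=> X _; rewrite /= lee_fin normrX ler_capped_moment.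
Qed.

Lemma second_moment_fin : second_moment \is a fin_num.
Proof.
rewrite fin_numM// integrable_fin_num//; exact: integrable_xi_palm.
Qed.

Definition pair_abs (x y : E) (X : config) : R := `|xi x X * xi y X|%R.
Definition pair_pos (x y : E) (X : config) : R := pospart (xi x X * xi y X).
Definition pair_neg (x y : E) (X : config) : R := negpart (xi x X * xi y X).
Definition pair_sqr (x y : E) (X : config) : R := (xi x X ^+ 2)%R.

Definition epair_sqr (x y : E) (X : config) : \bar R := (pair_sqr x y X)%:E.
Definition epair_pos (x y : E) (X : config) : \bar R := (pair_pos x y X)%:E.
Definition epair_neg (x y : E) (X : config) : \bar R := (pair_neg x y X)%:E.

Let epair_sqr_ge0 x y X : 0 <= epair_sqr x y X. Proof. by rewrite lee_fin sqr_ge0. Qed.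
Let epair_pos_ge0 x y X : 0 <= epair_pos x y X. Proof. by rewrite lee_fin pospart_ge0. Qed.
Let epair_neg_ge0 x y X : 0 <= epair_neg x y X. Proof. by rewrite lee_fin negpart_ge0. Qed.

Let mepair_sqr : measurable_fun setT (fun z : 2.-tuple E * config =>
  epair_sqr (tnth z.1 ord0) (tnth z.1 ord_max) z.2).
Proof. by apply/measurable_EFinP; exact: measurable_funX. Qed.

Let mepair_pos : measurable_fun setT (fun z : 2.-tuple E * config =>
  epair_pos (tnth z.1 ord0) (tnth z.1 ord_max) z.2).
Proof.
by apply/measurable_EFinP; apply: measurable_maxr => //; exact: measurable_funM.
Qed.

Let mepair_neg : measurable_fun setT (fun z : 2.-tuple E * config =>
  epair_neg (tnth z.1 ord0) (tnth z.1 ord_max) z.2).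
Proof.
apply/measurable_EFinP; apply: measurable_maxr => //; apply: measurableT_comp => //.
exact: measurable_funM.
Qed.

Let inv_sqr : invariant2 epair_sqr. Proof. by move=> x y u X; rewrite /epair_sqr /pair_sqr !xiD. Qed.
Let inv_pos : invariant2 epair_pos. Proof. by move=> x y u X; rewrite /epair_pos /pair_pos !xiD. Qed.
Let inv_neg : invariant2 epair_neg. Proof. by move=> x y u X; rewrite /epair_neg /pair_neg !xiD. Qed.

Let dens h : E -> \bar R := pair_density (rho := rho) (palm := palm) h.

(** Where rho^(2) vanishes the density is 0; elsewhere the moment condition
    on pairs applies. *)
Lemma pair_density_sqr_bound : exists2 C : R, (0 <= C)%R &
  \forall y \ae @lebd R d, dens epair_sqr y <= C%:E.
Proof.
have fp : (Posz 2 <= Num.floor p)%R by rewrite floor_ge_int; exact: (ltW p2).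
have [C C0 hC] := moment_ae adm mc fp.
have [M hM] := rho2b.
exists (C * Num.max M 0)%R; first by rewrite mulr_ge0// le_max lexx orbT.
apply: ae_pair_diff; apply: filterS2 hC hM => z hC hM.
rewrite /dens -(palm2_shift adm pv mepair_sqr epair_sqr_ge0 inv_sqr) -tuple2_eta.
have rz : (0 <= rho 2%N z)%R by exact: (rho_ge0 adm).
case: hC => [->|hC]; first by rewrite mule0 lee_fin mulr_ge0// le_max lexx orbT.
rewrite EFinM; apply: lee_pmul.
- by apply: integral_ge0 => X _.
- by rewrite lee_fin.
- apply: le_trans hC; apply: ge0_le_integral => //.
  + exact: (measurableT_comp mepair_sqr (measurable_pair1 z)).
  + exact: (measurable_capped_moment sc p (measurable_cst _) (@measurable_id _ _ _)).
  + by move=> X _; rewrite lee_fin /pair_sqr -real_normK ?num_real// ler_capped_moment.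
- by rewrite lee_fin le_max hM.
Qed.

Definition offdiag_sum (a : R) (h : E -> E -> config -> R) (w : Omega) : R :=
  (\sum_(x <- cpoints a (P w)) \sum_(y <- cpoints a (P w) | y != x) h x y (P w))%R.

Lemma integral_offdiag_sum a (h : E -> E -> config -> R) :
  measurable_fun setT (fun z : 2.-tuple E * config =>
    (h (tnth z.1 ord0) (tnth z.1 ord_max) z.2)%:E) ->
  (forall x y X, (0 <= h x y X)%R) ->
  (forall x y u X, h (vadd x u) (vadd y u) (cshift u X) = h x y X) ->
  \int[Pr]_w (offdiag_sum a h w)%:E =
  \int[lebd]_z (overlap a z * dens (fun x y X => (h x y X)%:E) z).
Proof.
move=> mh h0 inv.
rewrite /dens -(@campbell2 _ _ _ _ _ _ _ _ adm pv (fun x y X => (h x y X)%:E)).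
- by apply: eq_integral => w _; rewrite -sumEFin; apply: eq_bigr => x _; rewrite sumEFin.
- exact: mh.
- by move=> x y X; rewrite lee_fin.
- by move=> x y u X; rewrite inv.
Qed.

Let S a := mark_sum a xi.
Let V a := mark_sum a (fun x X => xi x X ^+ 2)%R.
Let T a := mark_sum a (fun x X => `|xi x X|)%R.
Let N a := mark_sum a (fun x X => 1)%R.

Let mS a : measurable_fun setT (S a). Proof. exact: measurable_mark_sum. Qed.
Let mV a : measurable_fun setT (V a).
Proof. by apply: measurable_mark_sum; exact: measurable_funX. Qed.
Let mT a : measurable_fun setT (T a).
Proof. by apply: measurable_mark_sum; exact: measurableT_comp. Qed.
Let mN a : measurable_fun setT (N a). Proof. exact: measurable_mark_sum. Qed.

Let offdiag_sum_abs a : offdiag_sum a pair_abs = (fun w => T a w ^+ 2 - V a w)%R.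
Proof.
apply/funext => w; rewrite /T /V /mark_sum.
under [X in (_ - X)%R]eq_bigr do rewrite -real_normK ?num_real//.
rewrite -offdiag_mul; last exact: uniq_cpoints.
by apply: eq_bigr => x _; apply: eq_bigr => y _; rewrite /pair_abs normrM.
Qed.

Let offdiag_sum_sqr a : offdiag_sum a pair_sqr = (fun w => V a w * N a w - V a w)%R.
Proof. by apply/funext => w; rewrite -offdiag_sqr//; exact: uniq_cpoints. Qed.

Let offdiag_sum_prod a w : (offdiag_sum a (fun x y X => xi x X * xi y X) w = S a w ^+ 2 - V a w)%R.
Proof. by rewrite -offdiag_mul//; exact: uniq_cpoints. Qed.

Let offdiag_sum_pos a : offdiag_sum a pair_pos =
  (fun w => ((T a w ^+ 2 - V a w) + (S a w ^+ 2 - V a w)) / 2)%R.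
Proof.
apply/funext => w; rewrite -offdiag_sum_prod -[X in (X + _)%R](congr1 (@^~ w) (offdiag_sum_abs a)).
rewrite /offdiag_sum -big_split/= mulr_suml; apply: eq_bigr => x _.
rewrite -big_split/= mulr_suml; apply: eq_bigr => y _; exact: pospart_half.
Qed.

Let offdiag_sum_neg a : offdiag_sum a pair_neg =
  (fun w => ((T a w ^+ 2 - V a w) - (S a w ^+ 2 - V a w)) / 2)%R.
Proof.
apply/funext => w; rewrite -offdiag_sum_prod -[X in (X - _)%R](congr1 (@^~ w) (offdiag_sum_abs a)).
rewrite /offdiag_sum -sumrB/= mulr_suml; apply: eq_bigr => x _.
rewrite -sumrB/= mulr_suml; apply: eq_bigr => y _; exact: negpart_half.
Qed.

Let moffdiag_sqr a : measurable_fun setT (offdiag_sum a pair_sqr).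
Proof. by rewrite offdiag_sum_sqr; apply: measurable_funB => //; exact: measurable_funM. Qed.

Let moffdiag_pos a : measurable_fun setT (offdiag_sum a pair_pos).
Proof.
rewrite offdiag_sum_pos; apply: measurable_funM => //; apply: measurable_funD;
  by apply: measurable_funB => //; exact: measurable_funX.
Qed.

Let moffdiag_neg a : measurable_fun setT (offdiag_sum a pair_neg).
Proof.
rewrite offdiag_sum_neg; apply: measurable_funM => //; apply: measurable_funB;
  by apply: measurable_funB => //; exact: measurable_funX.
Qed.

Let offdiag_sum_ge0 a (h : E -> E -> config -> R) w :
  (forall x y X, (0 <= h x y X)%R) -> (0 <= offdiag_sum a h w)%R.
Proof. by move=> h0; apply: sumr_ge0 => x _; apply: sumr_ge0 => y _. Qed.

Lemma integral_cube_overlap a : (0 <= a)%R ->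
  \int[@lebd R d]_z (cube_overlap a z)%:E = (((2 * a) ^+ d) ^+ 2)%R%:E.
Proof.
move=> a0; transitivity (\int[@lebd R d]_z (overlap a z * cst 1 z)).
  by apply: eq_integral => z _; rewrite mule1 overlapE.
rewrite -(@integral_cube_diff _ _ a (cst 1))//.
transitivity (\int[@lebd R d]_x ((\1_(cube a) x)%:E * @lebd R d (cube a))).
  apply: eq_integral => x _.
  under eq_integral do rewrite mule1 EFinM.
  rewrite ge0_integralZl//.
  - by rewrite (integral_indic lebd measurableT (@measurable_cube R d a)) setIT.
  - exact: measurable_indic_cube.
rewrite ge0_integralZr//; last exact: measurable_indic_cube.
rewrite (integral_indic lebd measurableT (@measurable_cube R d a)) setIT.
by rewrite [X in X * X](lebd_cube a0) -EFinM -expr2.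
Qed.

Lemma integral_offdiag_sqr_fin a : (0 <= a)%R -> \int[Pr]_w (offdiag_sum a pair_sqr w)%:E < +oo.
Proof.
move=> a0; have [C C0 hC] := pair_density_sqr_bound.
rewrite (integral_offdiag_sum a mepair_sqr) => [|x y X|x y u X]; first last.
- by rewrite /pair_sqr xiD.
- by rewrite sqr_ge0.
apply: (@le_lt_trans _ _ (\int[@lebd R d]_z ((cube_overlap a z)%:E * C%:E))).
  apply: ae_ge0_le_integral => //.
  - by move=> z _; rewrite mule_ge0 ?overlap_ge0 ?(pair_density_ge0 adm)//.
  - apply: emeasurable_funM; first exact: measurable_overlap.
    exact: (measurable_pair_density adm mepair_sqr).
  - by move=> z _; rewrite -EFinM lee_fin mulr_ge0// cube_overlap_ge0.
  - apply: emeasurable_funM => //; apply/measurable_EFinP; exact: measurable_cube_overlap.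
  - apply: filterS hC => z hz _; rewrite overlapE//.
    by rewrite lee_wpmul2l// lee_fin cube_overlap_ge0.
rewrite ge0_integralZr//.
- by rewrite integral_cube_overlap// -EFinM ltry.
- by apply/measurable_EFinP; exact: measurable_cube_overlap.
- by move=> z _; rewrite lee_fin cube_overlap_ge0.
Qed.

Let integrable_offdiag_sum a (q : E -> E -> config -> R) : (0 <= a)%R ->
  measurable_fun setT (offdiag_sum a q) ->
  (forall x y X, (0 <= q x y X <= pair_abs x y X)%R) ->
  Pr.-integrable setT (fun w => (offdiag_sum a q w)%:E).
Proof.
move=> a0 mq q01; apply/integrableP; split; first exact/measurable_EFinP.
apply: le_lt_trans (integral_offdiag_sqr_fin a0).
apply: ge0_le_integral => //.
- by apply: measurableT_comp => //; exact/measurable_EFinP.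
- exact/measurable_EFinP.
move=> w _; rewrite /= lee_fin ger0_norm; last first.
  by apply: offdiag_sum_ge0 => x y X; have /andP[] := q01 x y X.
apply: le_trans (offdiag_norm_le _ (fun x => xi x (P w))); last exact: uniq_cpoints.
by apply: ler_sum => x _; apply: ler_sum => y _; have /andP[] := q01 x y (P w).
Qed.

Let pair_pos_le x y X : (0 <= pair_pos x y X <= pair_abs x y X)%R.
Proof.
rewrite pospart_ge0 /pair_pos pospart_half /pair_abs.
have := ler_norm (xi x X * xi y X)%R; have := normr_ge0 (xi x X * xi y X)%R; lra.
Qed.

Let pair_neg_le x y X : (0 <= pair_neg x y X <= pair_abs x y X)%R.
Proof.
rewrite negpart_ge0 /pair_neg negpart_half /pair_abs.
have := ler_norm (- (xi x X * xi y X))%R; rewrite normrN.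
have := normr_ge0 (xi x X * xi y X)%R; lra.
Qed.

Let mpair z := m2 xi rho palm None vzero z.

(** If A and B are both infinite, both sides are -oo, or 0 when t = 0. *)
Let muleBl_ge0 (A B : \bar R) (t : R) : (0 <= t)%R -> 0 <= A -> 0 <= B ->
  (A - B) * t%:E = A * t%:E - B * t%:E.
Proof.
rewrite le_eqVlt => /predU1P[<- _ _|t0]; first by rewrite !mule0 sube0.
case: A => [A| |]//; case: B => [B| |]// _ _.
- by rewrite -EFinB -!EFinM -EFinB mulrBl.
- by rewrite gt0_mulye ?lte_fin//= gt0_mulNye ?lte_fin.
- by rewrite gt0_mulye ?lte_fin//= gt0_mulye ?lte_fin.
- by rewrite gt0_mulye ?lte_fin//= gt0_mulNye ?lte_fin.
Qed.

Lemma mpairE z : mpair z = dens epair_pos z - dens epair_neg z.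
Proof.
rewrite /mpair /m2; under eq_integral do rewrite windowed_None.
rewrite integralE muleBl_ge0 ?(rho_ge0 adm)//; last 2 first.
- by apply: integral_ge0 => X _; exact: funepos_ge0.
- by apply: integral_ge0 => X _; exact: funeneg_ge0.
rewrite /dens /pair_density; congr (_ * _ - _ * _); apply: eq_integral => X _.
- by rewrite funeposE -EFin_max.
- by rewrite funenegE -EFinN -EFin_max.
Qed.

Let integrable_overlap_dens a h : (0 <= a)%R ->
  measurable_fun setT (dens h) -> (forall z, 0 <= dens h z) ->
  \int[lebd]_z (overlap a z * dens h z) < +oo ->
  (@lebd R d).-integrable setT (fun z => (cube_overlap a z)%:E * dens h z).
Proof.
move=> a0 mG G0 fin; apply/integrableP; split.
  by apply: emeasurable_funM => //; apply/measurable_EFinP; exact: measurable_cube_overlap.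
apply: le_lt_trans fin; rewrite le_eqVlt; apply/orP; left; apply/eqP.
apply: eq_integral => z _; rewrite overlapE// gee0_abs// mule_ge0// lee_fin.
exact: cube_overlap_ge0.
Qed.

(** The positive and the negative part of the product of two scores satisfy
    the Campbell formula separately, and their difference is m_(2). *)
Lemma integral_overlap_m2 a : (0 <= a)%R ->
  (@lebd R d).-integrable setT (fun z => (cube_overlap a z)%:E * mpair z) /\
  \int[lebd]_z ((cube_overlap a z)%:E * mpair z) =
  \int[Pr]_w (offdiag_sum a pair_pos w)%:E - \int[Pr]_w (offdiag_sum a pair_neg w)%:E.
Proof.
move=> a0.
have Epos : \int[Pr]_w (offdiag_sum a pair_pos w)%:E = \int[lebd]_z (overlap a z * dens epair_pos z).
  apply: (@integral_offdiag_sum a pair_pos mepair_pos) => [x y X|x y u X]; first exact: pospart_ge0.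
  by rewrite /pair_pos !xiD.
have Eneg : \int[Pr]_w (offdiag_sum a pair_neg w)%:E = \int[lebd]_z (overlap a z * dens epair_neg z).
  apply: (@integral_offdiag_sum a pair_neg mepair_neg) => [x y X|x y u X]; first exact: negpart_ge0.
  by rewrite /pair_neg !xiD.
have Ipos : (@lebd R d).-integrable setT (fun z => (cube_overlap a z)%:E * dens epair_pos z).
  apply: integrable_overlap_dens => //.
  - exact: (measurable_pair_density adm mepair_pos).
  - exact: (pair_density_ge0 adm epair_pos_ge0).
  - by rewrite -Epos; apply: integrable_lty => //; exact: integrable_offdiag_sum.
have Ineg : (@lebd R d).-integrable setT (fun z => (cube_overlap a z)%:E * dens epair_neg z).
  apply: integrable_overlap_dens => //.
  - exact: (measurable_pair_density adm mepair_neg).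
  - exact: (pair_density_ge0 adm epair_neg_ge0).
  - by rewrite -Eneg; apply: integrable_lty => //; exact: integrable_offdiag_sum.
have E2 z : (cube_overlap a z)%:E * mpair z = (cube_overlap a z)%:E * dens epair_pos z - (cube_overlap a z)%:E * dens epair_neg z.
  rewrite mpairE muleC muleBl_ge0 ?cube_overlap_ge0 ?(pair_density_ge0 adm epair_pos_ge0)
    ?(pair_density_ge0 adm epair_neg_ge0)//.
  by rewrite muleC [X in _ - X]muleC.
under eq_integral do rewrite E2.
have -> : (fun z => (cube_overlap a z)%:E * mpair z) =
   (fun z => (cube_overlap a z)%:E * dens epair_pos z) \- (fun z => (cube_overlap a z)%:E * dens epair_neg z).
  by apply/funext.
split; first exact: integrableB.
rewrite integralB// Epos Eneg.
by congr (_ - _); apply: eq_integral => z _; rewrite overlapE.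
Qed.

Let mean : \bar R := m1 xi rho palm None vzero.

Let meanE : mean = \int[palm 1%N [tuple vzero]]_X (xi vzero X)%:E *
  (rho 1%N [tuple vzero])%:E.
Proof. by rewrite /mean /m1; under eq_integral do rewrite windowed_None. Qed.

Lemma mean_fin : mean \is a fin_num.
Proof.
rewrite meanE fin_numM// integrable_fin_num//.
exact: (@integrable_xi_palm 1).
Qed.

Let integral_mark_sum_part (f : R -> R) a : (0 <= a)%R -> measurable_fun setT f ->
  (forall r, 0 <= f r)%R -> (forall r, f r <= `|r|)%R ->
  [/\ \int[Pr]_w (mark_sum a (fun x X => f (xi x X)) w)%:E =
      ((2 * a) ^+ d)%R%:E * (\int[palm 1%N [tuple vzero]]_X (f (xi vzero X))%:E *
        (rho 1%N [tuple vzero])%:E),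
      (palm 1%N [tuple vzero]).-integrable setT (fun X => (f (xi vzero X))%:E) &
      Pr.-integrable setT (fun w => (mark_sum a (fun x X => f (xi x X)) w)%:E)].
Proof.
move=> a0 mf f0 fle.
have ip : (palm 1%N [tuple vzero]).-integrable setT (fun X => (f (xi vzero X))%:E).
  apply: le_integrable (integrable_xi_palm (isT : (1 <= 2)%N)) => //.
    by apply/measurable_EFinP; exact: (measurableT_comp mf).
  by move=> X _; rewrite /= lee_fin ger0_norm.
have e : \int[Pr]_w (mark_sum a (fun x X => f (xi x X)) w)%:E =
    ((2 * a) ^+ d)%R%:E * (\int[palm 1%N [tuple vzero]]_X (f (xi vzero X))%:E *
      (rho 1%N [tuple vzero])%:E).
  rewrite -(lebd_cube a0) -(@campbell1 _ _ _ _ _ _ _ _ adm pv a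
    (fun x X => (f (xi x X))%:E)).
  - by apply: eq_integral => w _; rewrite sumEFin.
  - by apply/measurable_EFinP; exact: (measurableT_comp mf).
  - by move=> x X; rewrite lee_fin.
  - by move=> x y X; rewrite xiD.
split => //; apply/integrableP; split.
  by apply/measurable_EFinP; apply: measurable_mark_sum; exact: (measurableT_comp mf).
under eq_integral do rewrite gee0_abs ?lee_fin ?sumr_ge0//.
rewrite e; apply: lte_mul_pinfty => //.
  by rewrite lee_fin exprn_ge0// mulr_ge0.
by rewrite ltey_eq fin_numM// integrable_fin_num.
Qed.

Lemma mark_sum_mean a : (0 <= a)%R ->
  Pr.-integrable setT (EFin \o mark_sum a xi) /\
  \int[Pr]_w (mark_sum a xi w)%:E = ((2 * a) ^+ d)%R%:E * mean.
Proof.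
move=> a0.
have mpos : measurable_fun setT (@pospart R) by exact: measurable_maxr.
have mneg : measurable_fun setT (@negpart R).
  by apply: measurable_maxr => //; exact: measurableT_comp.
have lepos r : (@pospart R r <= `|r|)%R.
  by rewrite pospart_half; have := ler_norm r; lra.
have leneg r : (@negpart R r <= `|r|)%R.
  by rewrite negpart_half; have := ler_norm (- r)%R; rewrite normrN; lra.
have [ep pp ip] := integral_mark_sum_part a0 mpos (@pospart_ge0 R) lepos.
have [en pn im] := integral_mark_sum_part a0 mneg (@negpart_ge0 R) leneg.
have E2 w : (mark_sum a xi w)%:E = (mark_sum a (fun x X => pospart (xi x X)) w)%:E -
    (mark_sum a (fun x X => negpart (xi x X)) w)%:E.
  by rewrite -EFinB /mark_sum -sumrB; congr EFin; apply: eq_bigr => x _; exact: posneg.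
split.
  by rewrite (_ : EFin \o _ = (fun w => (mark_sum a (fun x X => pospart (xi x X)) w)%:E)
    \- (fun w => (mark_sum a (fun x X => negpart (xi x X)) w)%:E));
    [exact: integrableB|apply/funext => w; exact: E2].
under eq_integral do rewrite E2.
rewrite integralB// ep en meanE.
have -> : \int[palm 1%N [tuple vzero]]_X (xi vzero X)%:E =
    \int[palm 1%N [tuple vzero]]_X (pospart (xi vzero X))%:E -
    \int[palm 1%N [tuple vzero]]_X (negpart (xi vzero X))%:E.
  rewrite -integralB//; apply: eq_integral => X _.
  by rewrite -EFinB -posneg.
rewrite [X in _ = _ * X]muleBl_ge0 ?(rho_ge0 adm)//; last 2 first.
- by apply: integral_ge0 => X _; rewrite lee_fin pospart_ge0.
- by apply: integral_ge0 => X _; rewrite lee_fin negpart_ge0.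
rewrite muleBr// fin_num_adde_defr// fin_numM// integrable_fin_num//.
Qed.

(** The squared mean, a multiple of vol(W)^2, is absorbed into the integral
    because vol(W)^2 is the integral of vol(W cap (W - z)) over z. *)
Lemma variance_mark_sum a : (0 <= a)%R ->
  'V_Pr[mark_sum a xi] = ((2 * a) ^+ d)%R%:E * second_moment +
    \int[lebd]_z ((cube_overlap a z)%:E * (m2 xi rho palm None vzero z - mean ^+ 2)).
Proof.
move=> a0.
have [iS ES] := mark_sum_mean a0.
have EV := integral_mark_sum_sqr a; rewrite (lebd_cube a0) in EV.
have V0 w : (0 <= V a w)%R by apply: sumr_ge0 => x _; exact: sqr_ge0.
have iV : Pr.-integrable setT (fun w => (V a w)%:E).
  apply/integrableP; split; first exact/measurable_EFinP.
  under eq_integral do rewrite gee0_abs ?lee_fin ?V0//.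
  by rewrite EV ltey_eq fin_numM// second_moment_fin.
have iP := integrable_offdiag_sum a0 (moffdiag_pos a) pair_pos_le.
have iN := integrable_offdiag_sum a0 (moffdiag_neg a) pair_neg_le.
have E2 w : (S a w * S a w)%:E = (V a w)%:E + ((offdiag_sum a pair_pos w)%:E - (offdiag_sum a pair_neg w)%:E).
  by rewrite -EFinB -EFinD offdiag_sum_pos offdiag_sum_neg; congr EFin; field.
have iS2 : Pr.-integrable setT (EFin \o (S a * S a)%R).
  rewrite (_ : _ \o _ = (fun w => (V a w)%:E) \+
    ((fun w => (offdiag_sum a pair_pos w)%:E) \- (fun w => (offdiag_sum a pair_neg w)%:E))).
    by apply: integrableD => //; exact: integrableB.
  by apply/funext => w; exact: E2.
have [iM EM] := integral_overlap_m2 a0.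
rewrite /variance covarianceE; first last.
- exact/Lfun1_integrable.
- exact/Lfun1_integrable.
- exact/Lfun1_integrable.
have expE (X : Omega -> R) : 'E_Pr[X] = \int[Pr]_w (X w)%:E by rewrite unlock.
rewrite !expE.
have -> : \int[Pr]_w ((mark_sum a xi * mark_sum a xi)%R w)%:E =
    ((2 * a) ^+ d)%R%:E * second_moment + \int[lebd]_z ((cube_overlap a z)%:E * mpair z).
  under eq_integral do rewrite E2.
  rewrite integralD//; last exact: integrableB.
  by rewrite integralB// EV EM.
have [m mE] : exists m, mean = m%:E by exists (fine mean); rewrite fineK// mean_fin.
rewrite ES mE -addeA; congr (_ + _).
have irl : (@lebd R d).-integrable setT (fun z => (cube_overlap a z)%:E * (m%:E ^+ 2)).
  under eq_fun do rewrite muleC.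
  apply: (@integrableZl _ _ _ lebd setT measurableT (m ^+ 2)%R).
  apply/integrableP; split; first by apply/measurable_EFinP; exact: measurable_cube_overlap.
  under eq_integral do rewrite gee0_abs ?lee_fin ?cube_overlap_ge0//.
  by rewrite integral_cube_overlap// ltry.
transitivity (\int[@lebd R d]_z ((cube_overlap a z)%:E * mpair z - (cube_overlap a z)%:E * (m%:E ^+ 2))).
  rewrite integralB//; congr (_ - _).
  rewrite ge0_integralZr//.
  - by rewrite integral_cube_overlap// -!EFinM; congr EFin; ring.
  - by apply/measurable_EFinP; exact: measurable_cube_overlap.
  - by move=> z _; rewrite lee_fin cube_overlap_ge0.
  - by rewrite -EFin_expe lee_fin sqr_ge0.
by apply: eq_integral => z _; rewrite muleBr// fin_num_adde_defl// -EFin_expe.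
Qed.

Lemma m2_shift x y : m2 xi rho palm None x y = m2 xi rho palm None vzero (vsub y x).
Proof.
rewrite [RHS]mpairE /dens -(palm2_shift adm pv mepair_pos epair_pos_ge0 inv_pos).
rewrite -(palm2_shift adm pv mepair_neg epair_neg_ge0 inv_neg).
rewrite /m2; under eq_integral do rewrite windowed_None.
rewrite integralE [LHS]muleBl_ge0 ?(rho_ge0 adm)//; last 2 first.
- by apply: integral_ge0 => X _; exact: funepos_ge0.
- by apply: integral_ge0 => X _; exact: funeneg_ge0.
congr (_ * _ - _ * _); apply: eq_integral => X _.
- by rewrite funeposE -EFin_max.
- by rewrite funenegE -EFinN -EFin_max.
Qed.

Lemma m1_shift x : m1 xi rho palm None x = m1 xi rho palm None vzero.
Proof.
rewrite -/mean meanE /m1; under eq_integral do rewrite windowed_None.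
have rhoE : rho 1%N [tuple x] = rho 1%N [tuple vzero].
  by rewrite tshift_tuple1 (rho_tshift adm).
rewrite rhoE integralE [in RHS]integralE.
have shiftE (f : R -> R) : measurable_fun setT f -> (forall r, 0 <= f r)%R ->
    \int[palm 1%N [tuple x]]_X (f (xi x X))%:E =
    \int[palm 1%N [tuple vzero]]_X (f (xi vzero X))%:E.
  move=> mf f0; rewrite (tshift_tuple1 x) (palm_tshift pv)//.
  - by apply: eq_integral => X _; rewrite -{1}(vadd0 x) xiD.
  - apply/measurable_EFinP; apply: (measurableT_comp mf).
    by case: sc => mx _ _ _; exact: mx.
  - by move=> X; rewrite lee_fin.
have mpos : measurable_fun setT (@pospart R) by exact: measurable_maxr.
have mneg : measurable_fun setT (@negpart R).
  by apply: measurable_maxr => //; exact: measurableT_comp.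
have ep := shiftE _ mpos (@pospart_ge0 R).
have en := shiftE _ mneg (@negpart_ge0 R).
congr ((_ - _) * _).
- transitivity (\int[palm 1%N [tuple x]]_X (pospart (xi x X))%:E).
    by apply: eq_integral => X _; rewrite funeposE -EFin_max.
  by rewrite ep; apply: eq_integral => X _; rewrite funeposE -EFin_max.
- transitivity (\int[palm 1%N [tuple x]]_X (negpart (xi x X))%:E).
    by apply: eq_integral => X _; rewrite funenegE -EFinN -EFin_max.
  by rewrite en; apply: eq_integral => X _; rewrite funenegE -EFinN -EFin_max.
Qed.

Lemma measurable_m2 : measurable_fun setT (m2 xi rho palm None vzero).
Proof.
rewrite (_ : m2 xi rho palm None vzero = fun z => dens epair_pos z - dens epair_neg z).
  apply: emeasurable_funB; first exact: (measurable_pair_density adm mepair_pos).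
  exact: (measurable_pair_density adm mepair_neg).
by apply/funext => z; exact: mpairE.
Qed.

End with_moments.
End variance.

(** * Asymptotics of the variance *)
Lemma enorm_vsubC (R : realType) (d : nat) (x y : Rd R d) :
  enorm (vsub x y) = enorm (vsub y x).
Proof.
rewrite /enorm; congr Num.sqrt; apply: eq_bigr => i _.
by rewrite !tnth_mktuple -sqrrN opprB.
Qed.

Lemma ae_neq_vzero (R : realType) (d : nat) : (0 < d)%N ->
  \forall y \ae @lebd R d, y <> vzero.
Proof.
move=> d0; exists (cube 0); split; first exact: measurable_cube.
  rewrite [LHS](lebd_cube (lexx 0%R)) mulr0 expr0n.
  by case: d d0.
move=> y /contrapT -> i; rewrite tnth_mktuple oppr0 lexx//.
Qed.

Local Open Scope ring_scope.

Theorem theorem1p15 (R : realType) (d : nat) (d_ge2 : (2 <= d)%N)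
    (disp : measure_display) (Omega : measurableType disp)
    (Pr : probability Omega R) (P : {mfun Omega >-> config R d})
    (rho : forall k : nat, k.-tuple (Rd R d) -> R)
    (palm : forall k : nat, R.-pker (k.-tuple (Rd R d)) ~> (config R d))
    (xi : Rd R d -> config R d -> R) (p : R) :
  admissible Pr P rho ->
  palm_version Pr P palm ->
  (exists M : R, \forall z \ae lebdk 2, rho 2%N z <= M) ->
  score_function xi ->
  exp_stabilizing xi Pr P palm ->
  2 < p -> moment_condition xi Pr P palm p ->
  fast_decorrelation xi rho palm ->
  [/\ sigma2 xi rho palm \is a fin_num,
      ((n%:R^-1)%:E * 'V_Pr[Hhat xi P n])%E @[n --> \oo]
        --> sigma2 xi rho palm &
      sigma2 xi rho palm = 0%E ->
      (0 <= sigma2_gamma xi rho palm < +oo)%E /\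
      ((n%:R `^ (- boundary_exponent R d))%:E * 'V_Pr[Hhat xi P n])%E
        @[n --> \oo] --> sigma2_gamma xi rho palm].
Proof.
move=> adm pv rho2b sc _ p2 mc fd.
have d0 : (0 < d)%N by rewrite (leq_trans _ d_ge2).
have [m mE] : exists m, m1 xi rho palm None vzero = m%:E.
  by exists (fine (m1 xi rho palm None vzero)); rewrite fineK// (mean_fin adm pv sc p2 mc).
have [v vE] : exists v, second_moment (rho := rho) (palm := palm) (xi := xi) = v%:E.
  by exists (fine (second_moment (rho := rho) (palm := palm) (xi := xi)));
    rewrite fineK// (second_moment_fin adm pv sc p2 mc).
pose F z : \bar R := (m2 xi rho palm None vzero z - m%:E ^+ 2)%E.
have mF : measurable_fun setT F.
  by apply: emeasurable_funB => //; exact: (measurable_m2 adm sc).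
have [phi [C [c [fphi c0 hphi]]]] := fd.
have [K K0 hK] := @fast_decreasing_majorant R d phi c fphi c0.
have Fphi : \forall y \ae lebd, (`|F y| <= (C * phi (c * enorm y))%:E)%E.
  suff h : \forall y \ae lebd, y <> vzero -> (`|F y| <= (C * phi (c * enorm y))%:E)%E.
    by apply: filterS2 h (@ae_neq_vzero R d d0) => y hy y0; exact: hy.
  apply: ae_pair_diff; apply: filterS (hphi None isT) => z /= hz z0.
  rewrite /F -mE; move: hz.
  rewrite (m2_shift adm pv sc) !(m1_shift adm pv sc) enorm_vsubC expe2.
  apply => z01; apply: z0; rewrite z01.
  by apply: eq_from_tnth => i; rewrite !tnth_mktuple subrr.
(* F is finite almost everywhere: its integrals are those of the real function f. *)
pose f z := fine (F z).
have mf : measurable_fun setT f by exact: measurableT_comp.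
have Ff : \forall y \ae lebd, F y = (f y)%:E.
  apply: filterS Fphi => y hy; rewrite /f fineK//.
  by rewrite fin_num_abs (le_lt_trans hy)// ltry.
have fK : \forall y \ae lebd, (1 + ell1 y) * `|f y| <= (`|C| * K) * majorant y.
  apply: filterS2 Fphi Ff => y hy fy; move: hy; rewrite fy /= lee_fin => hy.
  have p0 : 0 <= phi (c * enorm y).
    have [phi01 _ _] := fphi.
    by have /andP[] := phi01 _ (mulr_ge0 (ltW c0) (enorm_ge0 y)).
  apply: (@le_trans _ _ (`|C| * ((1 + ell1 y) * phi (c * enorm y)))).
    rewrite mulrCA; apply: ler_wpM2l; first by rewrite addr_ge0// ell1_ge0.
    by apply: (le_trans hy); apply: ler_wpM2r => //; exact: ler_norm.
  by rewrite -mulrA; apply: ler_wpM2l.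
have [if_ cvgf] := cvg_integral_overlap d0 mf fK.
have [igf cvggf] := cvg_integral_defect d0 mf fK.
set If := (\int[lebd]_z (f z)%:E)%E in cvgf.
have IfE : If = (fine If)%:E by rewrite fineK// integrable_fin_num.
have s2E : sigma2 xi rho palm = (v%:E + If)%E.
  rewrite /sigma2 -vE; congr (_ + _)%E.
  rewrite mE; apply: ae_eq_integral => //; first exact/measurable_EFinP.
  by apply: filterS Ff => z fz _.
have irf n : (@lebd R d).-integrable setT (fun z => (cube_overlap (window_side R d n / 2) z * f z)%:E).
  apply: (le_integrable measurableT _ _ (integrableZl measurableT n%:R if_)).
    by apply/measurable_EFinP; apply: measurable_funM => //; exact: measurable_cube_overlap.
  move=> z _; rewrite -EFinM !abse_EFin lee_fin !normrM.
  apply: ler_wpM2r => //; rewrite !ger0_norm ?cube_overlap_ge0//.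
  have [->|n0] := posnP n; last by rewrite -(@window_side_exp R d d0 n) cube_overlap_le// window_side_gt0.
  rewrite /cube_overlap /window_side powR0 ?mul0r; last by rewrite invr_eq0 pnatr_eq0 -lt0n.
  by rewrite (bigD1 (Ordinal d0))//= /overlap_length mulr0 sub0r max_l ?mul0r ?oppr_le0.
have VE n : 'V_Pr[Hhat xi P n]%E =
    (n%:R * v)%:E + (\int[lebd]_z (cube_overlap (window_side R d n / 2) z * f z)%:E)%E :> \bar R.
  have -> : Hhat xi P n = mark_sum (P := P) (window_side R d n / 2) xi.
    apply/funext => w; rewrite /Hhat windowE fsbig_finite//; exact: finite_cube.
  rewrite (variance_mark_sum adm pv sc p2 mc rho2b) ?divr_ge0 ?window_side_ge0//.
  have -> : 2 * (window_side R d n / 2) = window_side R d n by field.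
  rewrite (window_side_exp d0) vE mE; congr (_ + _)%E.
  apply: ae_eq_integral => //.
  - by apply: emeasurable_funM => //; apply/measurable_EFinP; exact: measurable_cube_overlap.
  - by apply/measurable_EFinP; apply: measurable_funM => //; exact: measurable_cube_overlap.
  - by apply: filterS Ff => z fz _; rewrite -/(F z) fz EFinM.
pose J n := fine (\int[lebd]_z (cube_overlap (window_side R d n / 2) z * f z)%:E)%E.
have JE n : (\int[lebd]_z (cube_overlap (window_side R d n / 2) z * f z)%:E)%E = (J n)%:E.
  by rewrite /J fineK// integrable_fin_num.
split.
- by rewrite s2E IfE -EFinD.
- rewrite s2E; apply: (@cvg_trans _ ((v%:E +
    \int[lebd]_z (cube_overlap (window_side R d n / 2) z / n%:R * f z)%:E)%E @[n --> \oo])).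
    apply: near_eq_cvg; near=> n.
    have n0 : (0 < n)%N by near: n; exact: nbhs_infty_gt.
    have nn0 : n%:R != 0 :> R by rewrite pnatr_eq0 -lt0n.
    have -> : (\int[lebd]_z (cube_overlap (window_side R d n / 2) z / n%:R * f z)%:E)%E =
        (n%:R^-1 * J n)%:E.
      rewrite EFinM -JE -integralZl//; apply: eq_integral => z _.
      by rewrite -EFinM; congr EFin; ring.
    by rewrite VE JE -!EFinD -EFinM mulrDr mulKf.
  by apply: cvgeD; [rewrite fin_num_adde_defr|exact: cvg_cst|exact: cvgf].
move=> s20.
(* This makes the terms n v and n If of volume order cancel. *)
have vIf : v = - fine If.
  move: s20; rewrite s2E IfE -EFinD => -[] h.
  by apply/eqP; rewrite -addr_eq0 h.
have gE : sigma2_gamma xi rho palm = (- \int[lebd]_z (ell1 z * f z)%:E)%E.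
  rewrite -integralN; last exact: integrable_add_def.
  rewrite /sigma2_gamma mE; under [LHS]eq_integral => x _ do rewrite (@gammaE R d d0 x).
  apply: ae_eq_integral => //.
  - apply: emeasurable_funM; last by apply/measurable_EFinP; exact: measurable_ell1.
    by apply: emeasurable_funB => //; exact: (measurable_m2 adm sc).
  - apply: measurableT_comp => //; apply/measurable_EFinP; apply: measurable_funM => //.
    exact: measurable_ell1.
  - apply: filterS Ff => z fz _.
    have -> : (m%:E ^+ 2 - m2 xi rho palm None vzero z = - F z)%E.
      by rewrite /F oppeB ?fin_num_adde_defl -?EFin_expe// addeC.
    by rewrite fz -!EFinN -EFinM; congr EFin; ring.
have cvg2 : ((n%:R `^ (- boundary_exponent R d))%:E * 'V_Pr[Hhat xi P n])%E
    @[n --> \oo] --> sigma2_gamma xi rho palm.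
  rewrite gE; apply: (@cvg_trans _ ((- \int[lebd]_z
    ((n%:R - cube_overlap (window_side R d n / 2) z) / window_side R d n ^+ d.-1 * f z)%:E)%E @[n --> \oo])).
    apply: near_eq_cvg; near=> n.
    have n0 : (0 < n)%N by near: n; exact: nbhs_infty_gt.
    have -> : (\int[lebd]_z
        ((n%:R - cube_overlap (window_side R d n / 2) z) / window_side R d n ^+ d.-1 * f z)%:E)%E =
        ((window_side R d n ^+ d.-1)^-1 * (n%:R * fine If - J n))%:E.
      rewrite EFinM EFinB EFinM -JE -IfE -integralZl// -integralB//; last first.
        exact: integrableZl.
      rewrite -integralZl//; last first.
        by apply: integrableB => //; exact: integrableZl.
      by apply: eq_integral => z _; rewrite /=; congr EFin; ring.
    rewrite window_side_boundary// VE JE -EFinD -EFinM -EFinN; congr EFin.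
    by rewrite vIf; ring.
  exact: cvgeN.
split => //; apply/andP; split.
  rewrite -(cvg_lim _ cvg2)//; apply: lime_ge; first exact: cvgP cvg2.
  apply: nearW => n.
  by rewrite mule_ge0// ?lee_fin ?powR_ge0// variance_ge0.
by rewrite gE lteNl ltNye_eq; apply/orP; left; exact: integrable_fin_num.
Unshelve. all: by end_near. Qed.
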